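(* Let $H$ be a Hilbert space and let $\mathcal T=(T(t))_{t\ge 0}\subset\mathcal L(H)$ be a semigroup (no measurability or continuity assumed). Suppose that there exist equivalent Hilbertian norms $\|\cdot\|_1$ and $\|\cdot\|_2$ on $H$, constants $C_1,C_2\ge 1$, and parameters $\lambda,\tau>0$ such that $$\|h\|\le\|h\|_j\le C_j\|h\|\quad(h\in H,\ j=1,2),\qquad \|T(t)\|_1\le e^{\lambda t}\quad(t\ge 0),\qquad \|T(\tau)\|_2\le 1 .$$ Then $$\mathcal C(\mathcal T)\le C_1\,\frac{\sinh(2\lambda)}{\lambda}+2\sqrt2\,C_2\max\{1,\sqrt\tau\}\sup_{t\in[0,\max\{1,\tau\}]}\|T(t)\|^2 .$$
   Context: $\mathcal L(H)$ denotes the bounded operators on $H$. A semigroup is a family $(T(t))_{t\ge0}\subset\mathcal L(H)$ with $T(0)=I$ and $T(s+t)=T(s)T(t)$. A Hilbertian norm is a norm induced by an inner product; $\|T\|_j$ is the operator norm of $T$ with respect to $\|\cdot\|_j$. The similarity constant is $$\mathcal C(\mathcal T):=\inf\{\|R\|\,\|R^{-1}\|:\ R\in\mathcal L(H)\text{ invertible},\ \|RT(t)R^{-1}\|\le1\text{ for all }t\ge0\},$$ with $\mathcal C(\mathcal T)=\infty$ if no such $R$ exists. *)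

(* Defs.v *)
From HB Require Import structures.
From mathcomp Require Import all_boot all_order all_algebra.
From mathcomp Require Import complex sesquilinear.
From mathcomp Require Import all_classical all_reals all_analysis.

Set Implicit Arguments.
Unset Strict Implicit.
Unset Printing Implicit Defensive.

Import Order.TTheory GRing.Theory Num.Theory.
Import numFieldNormedType.Exports.

Local Open Scope classical_set_scope.
Local Open Scope ring_scope.

(* Hilbert spaces may be real or complex; [scalar_field R] is the choice
   between the two, coerced to the corresponding field. *)
Inductive scalar_field (R : realType) : Type := Real_field | Complex_field.
Arguments Real_field {R}.
Arguments Complex_field {R}.

Definition scalars (R : realType) (F : scalar_field R) : numFieldType :=
  match F with Real_field => R | Complex_field => R[i] end.
Coercion scalars : scalar_field >-> numFieldType.

Definition conjs (R : realType) (F : scalar_field R) : F -> F :=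
  match F with Real_field => idfun | Complex_field => @Num.conj R[i] end.

Definition re (R : realType) (F : scalar_field R) : F -> R :=
  match F with Real_field => idfun | Complex_field => @complex.Re R end.

Section Definitions.
Context {R : realType} {F : scalar_field R}.

Definition hilbertian_norm (V : lmodType F) (N : V -> R) : Prop :=
  exists ip : {dot V for @conjs R F}, forall h, N h = Num.sqrt (re (ip h h)).

Context {H : completeNormedModType F}.
Implicit Types (N : H -> R) (T : R -> {linear H -> H}).

(* The norm [`|h|] takes its values in the scalar field; [hnorm] is the same
   norm with values in [R]. *)
Definition hnorm (h : H) : R := re `|h|.

Definition equivalent_norms N N' : Prop :=
  exists a b : R, [/\ 0 < a, 0 < b & forall h, a * N h <= N' h <= b * N h].

Definition opnorm N (f : H -> H) : \bar R :=
  ereal_sup [set (N (f h))%:E | h in [set h | N h <= 1]].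

Definition bounded_operator (f : {linear H -> H}) : Prop :=
  bounded_near f (nbhs (0 : H)).

(* Only the values of [T] at nonnegative times are constrained. *)
Definition semigroup T : Prop :=
  [/\ forall t, 0 <= t -> bounded_operator (T t),
      forall h, T 0 h = h
    & forall s t h, 0 <= s -> 0 <= t -> T (s + t) h = T s (T t h)].

(* [A] is invertible in L(H), with inverse [B]. *)
Definition invertible_operator (A B : {linear H -> H}) : Prop :=
  [/\ bounded_operator A, bounded_operator B, cancel A B & cancel B A].

(* The infimum of the empty set is [+oo]. *)
Definition similarity_constant T : \bar R :=
  ereal_inf [set c | exists A B : {linear H -> H},
    [/\ invertible_operator A B,
        forall t, 0 <= t -> (opnorm hnorm (A \o T t \o B) <= 1)%E
      & c = (opnorm hnorm A * opnorm hnorm B)%E]].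

End Definitions.

Definition sinh (R : realType) (x : R) : R := (expR x - expR (- x)) / 2.

(* Main.v *)
Require Import Defs.
From HB Require Import structures.
From mathcomp Require Import all_boot all_order all_algebra.
From mathcomp Require Import complex sesquilinear.
From mathcomp Require Import all_classical all_reals all_analysis.
From mathcomp Require Import ring lra.

Set Implicit Arguments.
Unset Strict Implicit.
Unset Printing Implicit Defensive.

Import Order.TTheory GRing.Theory Num.Theory.
Import numFieldNormedType.Exports.

Local Open Scope classical_set_scope.
Local Open Scope ring_scope.

(** A Hilbertian norm [sqrt q] with [hnorm h <= sqrt (q h) <= K * hnorm h] that no
[T t] increases gives [similarity_constant T <= K]: if [S] is the positive
operator that represents [q], then [A := S^(1/2)] satisfies
[hnorm (A h) ^+ 2 = q h], so [A] conjugates the semigroup to contractions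
([contractive_similarity]).  There are thus two tasks: to build such a [q]
([renorming]), and to extract the square root ([quadratic_square_root]).

Building [q].  A finite family [e] of pairs [(t, h)] stands for a superposition
of orbits: the orbit of [h] starts at time [- t], so that [T t h] is its value
at time 0, and [terminal e] is the sum of these values.  Applying [T s] amounts
to starting all orbits earlier by [s].  Hence a quadratic function [Q] of [e]
that decreases under this translation induces a quadratic function
[q h := inf {Q e | terminal e = h}] on [H] that the semigroup decreases.  Fix a
time [x] in [[- min 1 tau, 0[].  The orbits started after [x] contribute
[early e x] to [terminal e], the others contribute [T (- x)] applied to their
value [late e x] at time [x].  The first part is measured by [N1], with a weight
[expR (2 * lambda * (x + 1))] that makes up for the growth of [N1] along orbits.
The second is measured by [late_energy], built from [N2] so that it decreases
when [x] moves by the period [tau]; this uses that [T tau] contracts [N2] and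
that the superposition is carried by [T tau] from time [x] to [x + tau] as soon
as [0 <= x].  The function [Q] is the average over one period of a combination
of both energies with coefficients proportional to [1 + eps] and [1 + eps^-1],
since [|u + v|^2 <= (1 + eps) |u|^2 + (1 + eps^-1) |v|^2].  For the right [eps]
one gets [K] as soon as [k1 + k2 < K], where [k1 = C1 * expR lambda] and [k2]
is the second term of the claimed bound; and
[expR lambda < sinh (2 * lambda) / lambda].

As the orbits need not be measurable, the averages over a period are taken with
a translation-invariant mean on all bounded functions of the real line
([exists_invariant_mean]).  Its values are never
computed: the weight of a window is bounded from below by covering a period with
translates of the window ([window_mean]).

Extracting the square root.  To treat real and complex scalars together, a
quadratic function is a nonnegative function satisfying the parallelogram law
and [q (c *: u) = |c|^2 * q u]; its real inner product [polar q] is bilinear by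
the Jordan-von Neumann argument.  Minimizing [q u - 2 * f u] represents bounded
functionals ([lax_milgram]), which yields [S] and, later on, the inverse of [A].
Writing [S = K^2 (1 - X)] with [X] a strict contraction, the iteration
[Y := (X + Y^2) / 2] converges to [Y] with [(1 - Y)^2 = 1 - X]. *)

(** * Real and complex scalars *)

Definition real_scalar (R : realType) (F : scalar_field R) : R -> F :=
  match F with Real_field => idfun | Complex_field => real_complex R end.

Section Scalars.
Context {R : realType} {F : scalar_field R}.
Implicit Types (x y : F) (a b : R).
Local Notation iota := (@real_scalar R F).

Lemma real_scalar0 : iota 0 = 0. Proof. by case: F. Qed.
Lemma real_scalar1 : iota 1 = 1. Proof. by case: F. Qed.
Lemma real_scalarD a b : iota (a + b) = iota a + iota b.
Proof. by case: F => //=; rewrite rmorphD. Qed.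
Lemma real_scalarM a b : iota (a * b) = iota a * iota b.
Proof. by case: F => //=; rewrite rmorphM. Qed.
Lemma re_real_scalar a : re (iota a) = a. Proof. by case: F. Qed.
Lemma reD x y : re (x + y) = re x + re y.
Proof. by case: F x y => //= -[? ?] [? ?]. Qed.
Lemma real_scalar_re x : 0 <= x -> iota (re x) = x.
Proof. case: F x => //= -[u v]; rewrite lecE /= => /andP[/eqP -> _] //. Qed.
Lemma re_real_scalarM a x : re (iota a * x) = a * re x.
Proof. by case: F x => //= -[u v] /=; ring. Qed.
Lemma ler_re x y : x <= y -> re x <= re y.
Proof. by case: F x y => //= -[? ?] [? ?]; rewrite lecE => /andP[]. Qed.
Lemma ltr_re x y : x < y -> re x < re y.
Proof. by case: F x y => //= -[? ?] [? ?]; rewrite ltcE => /andP[]. Qed.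
Lemma ler_real_scalar a b : (iota a <= iota b) = (a <= b).
Proof. by case: F => //=; rewrite lecR. Qed.
Lemma ltr_real_scalar a b : (iota a < iota b) = (a < b).
Proof. by case: F => //=; rewrite ltcR. Qed.
Lemma real_scalar_ge0 a : (0 <= iota a) = (0 <= a).
Proof. by rewrite -real_scalar0 ler_real_scalar. Qed.

Lemma real_scalar_gt0 a : (0 < iota a) = (0 < a).
Proof. by rewrite -real_scalar0 ltr_real_scalar. Qed.
Lemma re0 : re (0 : F) = 0. Proof. by case: F. Qed.

Definition modulus x : R := re `|x|.
Lemma real_scalar_modulus x : iota (modulus x) = `|x|.
Proof. by rewrite real_scalar_re. Qed.
Lemma modulus_real_scalar a : modulus (iota a) = `|a|.
Proof.
by rewrite /modulus; case: F => //=; rewrite expr0n /= addr0 sqrtr_sqr.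
Qed.
Lemma re_conj x : re (x * conjs x) = modulus x ^+ 2.
Proof.
rewrite /modulus; case: F x => //= x; first by rewrite real_normK ?num_real.
rewrite -normCK; have -> : `|x| = (Normc.normc x)%:C%C by [].
by rewrite -rmorphXn.
Qed.
Lemma modulus_ge0 x : 0 <= modulus x.
Proof. by rewrite -real_scalar_ge0 real_scalar_modulus. Qed.
Lemma modulusM x y : modulus (x * y) = modulus x * modulus y.
Proof. by rewrite /modulus normrM -{1}real_scalar_modulus re_real_scalarM. Qed.
Lemma modulus_eq0 x : (modulus x == 0) = (x == 0).
Proof.
rewrite -[RHS]normr_eq0 -real_scalar_modulus.
by apply/eqP/eqP => [->|/(congr1 (@re R F))]; rewrite ?real_scalar0 ?re0 ?re_real_scalar.
Qed.
Lemma modulus0 : modulus (0 : F) = 0.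
Proof. by apply/eqP; rewrite modulus_eq0. Qed.
Lemma modulus1 : modulus (1 : F) = 1.
Proof. by rewrite -real_scalar1 modulus_real_scalar normr1. Qed.
End Scalars.

(** * Quadratic functions and polarization *)

Section QuadraticFunctions.
Context {R : realType} {F : scalar_field R}.
Local Notation iota := (@real_scalar R F).

(** Squares of Hilbertian seminorms, described without an inner product.  In this
form the notion is visibly stable under positive combinations, means and
quotients, which is how the new norm is assembled. *)
Definition quadratic (V : lmodType F) (q : V -> R) : Prop :=
  [/\ forall u, 0 <= q u,
      forall u v, q (u + v) + q (u - v) = 2 * q u + 2 * q v
    & forall c u, q (c *: u) = modulus c ^+ 2 * q u].

(** The real part of the inner product: this real bilinear form carries all the
information also when the scalars are complex, since [polarZZ] recovers
sesquilinearity. *)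
Definition polar (V : lmodType F) (q : V -> R) (u v : V) : R :=
  (q (u + v) - q (u - v)) / 4.

Context {V : lmodType F} (q : V -> R) (qq : quadratic q).
Implicit Types (u v w : V).

Let q_ge0 u : 0 <= q u. Proof. by case: qq. Qed.
Let qpar u v : q (u + v) + q (u - v) = 2 * q u + 2 * q v.
Proof. by case: qq. Qed.
Let qZ c u : q (c *: u) = modulus c ^+ 2 * q u. Proof. by case: qq. Qed.

Lemma quadratic_real a u : q (iota a *: u) = a ^+ 2 * q u.
Proof. by rewrite qZ modulus_real_scalar real_normK ?num_real. Qed.

Lemma quadratic0 : q 0 = 0.
Proof. by have := qpar 0 0; rewrite !addr0 subr0; lra. Qed.

Lemma quadraticN u : q (- u) = q u.
Proof. by have := qpar 0 u; rewrite quadratic0 add0r sub0r; lra. Qed.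

Lemma quadraticD_le u v : q (u + v) <= 2 * q u + 2 * q v.
Proof. by rewrite -qpar lerDl. Qed.

Lemma polarC u v : polar q u v = polar q v u.
Proof. by rewrite /polar (addrC u v) -[u - v]opprB quadraticN. Qed.

Lemma polar_diag u : polar q u u = q u.
Proof. by have := qpar u u; rewrite /polar subrr quadratic0; lra. Qed.

Lemma polarNl u v : polar q (- u) v = - polar q u v.
Proof. by rewrite /polar -opprD (addrC (- u)) -[v - u]opprB !quadraticN; lra. Qed.

Let q3 u v w :
  q (u + v + w) = q (u + w) + q (v + w) + q (u + v) - q u - q v - q w.
Proof.
have := qpar (u + w) v; have := qpar (v + w) u; have := qpar w (u - v).
have := qpar u v.
rewrite [v + w + u](_ : _ = u + v + w); last by rewrite addrC addrA.
rewrite [u + w + v](_ : _ = u + v + w); last by rewrite addrAC.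
rewrite [v + w - u](_ : _ = w - (u - v)); last by rewrite opprB addrCA addrA.
rewrite [u + w - v](_ : _ = w + (u - v)); last by rewrite addrA (addrC w).
by lra.
Qed.

(** The additivity half of the Jordan-von Neumann theorem: apply [q3] to [w] and
to [- w] and subtract. *)
Lemma polarDl u v w : polar q (u + v) w = polar q u w + polar q v w.
Proof.
by rewrite /polar (q3 u v w) (q3 u v (- w)) quadraticN; lra.
Qed.

Lemma quadraticD u v : q (u + v) = q u + 2 * polar q u v + q v.
Proof. by have := qpar u v; rewrite /polar; lra. Qed.

Lemma ler_polar u v : `|polar q u v| <= (q u + q v) / 2.
Proof.
have := qpar u v; have := q_ge0 (u + v); have := q_ge0 (u - v).
by rewrite ler_norml /polar => *; apply/andP; split; lra.
Qed.

(** An additive function of one real variable that is bounded on [[0, 1[] is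
linear: its defect from linearity is additive and vanishes at 1, so it is
1-periodic, hence bounded, hence zero. *)
Lemma polarZl a u v : polar q (iota a *: u) v = a * polar q u v.
Proof.
pose d b := polar q (iota b *: u) v - b * polar q u v.
have dD b c : d (b + c) = d b + d c.
  by rewrite /d real_scalarD scalerDl polarDl mulrDl; lra.
have d0 : d 0 = 0 by have := dD 0 0; rewrite addr0; lra.
have dN b : d (- b) = - d b by have := dD b (- b); rewrite subrr d0; lra.
have dMn b n : d (b *+ n) = d b *+ n.
  by elim: n => [|n IH]; rewrite ?mulr0n // !mulrS dD IH.
have d1 : d 1 = 0 by rewrite /d real_scalar1 scale1r mul1r subrr.
have dZ b (n : int) : d (b - n%:~R) = d b.
  have -> : d (b - n%:~R) = d b + d (- n%:~R) by rewrite dD.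
  rewrite dN; suff -> : d n%:~R = 0 by rewrite subr0.
  case: n => n; first by rewrite -pmulrn dMn d1 mul0rn.
  by rewrite NegzE mulrNz -pmulrn dN dMn d1 mul0rn oppr0.
pose B := (q u + q v) / 2 + `|polar q u v|.
have dB b : `|d b| <= B.
  rewrite -(dZ b (Num.floor b)); set c := b - _.
  have c0 : 0 <= c by rewrite subr_ge0 floor_le.
  have c1 : c <= 1.
    by have := floorD1_gt b; rewrite intrD /c; lra.
  rewrite (le_trans (ler_normB _ _)) // lerD //.
    rewrite (le_trans (ler_polar _ _)) // ler_pM2r ?invr_gt0 // lerD2r.
    by rewrite quadratic_real ler_piMl // expr_le1.
  by rewrite normrM ler_piMl // ger0_norm.
suff : d a = 0 by rewrite /d; lra.
apply/eqP; rewrite -normr_le0 leNgt; apply/negP => da.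
have B0 : 0 <= B by apply: le_trans (dB 0).
have := dB (a *+ (Num.truncn (B / `|d a|)).+1).
rewrite dMn normrMn leNgt -mulr_natl -ltr_pdivrMr //.
by rewrite truncnS_gt.
Qed.

Lemma discriminant (A B C : R) : 0 <= A ->
  (forall t, 0 <= A * t ^+ 2 + 2 * t * B + C) -> B ^+ 2 <= A * C.
Proof.
rewrite le_eqVlt => /orP[/eqP <- H|A0 H].
  rewrite mul0r; have [->|B0] := eqVneq B 0; first by rewrite expr0n.
  have := H (- (C + 1) / (2 * B)).
  rewrite mul0r add0r [2 * _ * B](_ : _ = - (C + 1)); last by field.
  by lra.
have := mulr_ge0 (ltW A0) (H (- B / A)).
have -> : A * (A * (- B / A) ^+ 2 + 2 * (- B / A) * B + C) = A * C - B ^+ 2.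
  by field; rewrite gt_eqF.
by rewrite subr_ge0.
Qed.

Lemma polar_CauchySchwarz u v : polar q u v ^+ 2 <= q u * q v.
Proof.
rewrite mulrC; apply: discriminant => // t.
have := q_ge0 (u + iota t *: v).
by rewrite quadraticD quadratic_real polarC polarZl polarC; lra.
Qed.

Lemma polarZZ c u v : polar q (c *: u) (c *: v) = modulus c ^+ 2 * polar q u v.
Proof. by rewrite /polar -scalerDr -scalerBr !qZ; lra. Qed.

End QuadraticFunctions.

(** * Hilbert spaces *)

Section HilbertSpaces.
Context {R : realType} {F : scalar_field R}.
Local Notation iota := (@real_scalar R F).

Lemma hilbertian_norm_quadratic (V : lmodType F) (N : V -> R) :
  hilbertian_norm N -> quadratic (fun h => N h ^+ 2).
Proof.
move=> [ip Nip].
have ip_ge0 h : 0 <= re (ip h h).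
  have [->|h0] := eqVneq h 0.
    by rewrite linear0l re0.
  by have := ltr_re (neq0_dnorm_gt0 (s := ip) h h0); rewrite re0; exact: ltW.
have sq h : N h ^+ 2 = re (ip h h) by rewrite Nip sqr_sqrtr.
split=> [u|u v|c u]; first exact: sqr_ge0.
  rewrite !sq.
  have -> : ip (u + v) (u + v) = ip u u + ip u v + (ip v u + ip v v).
    by rewrite linearDl !linearDr.
  have -> : ip (u - v) (u - v) = ip u u - ip u v + (- ip v u + ip v v).
    by rewrite linearDl !linearDr !linearNl !linearNr opprK.
  have reN (x : F) : re (- x) = - re x.
    by case: F x => //= -[].
  by rewrite !reD !reN; lra.
rewrite !sq linearZl_LR linearZr_LR /=.
have ip_real : iota (re (ip u u)) = ip u u.
  have [->|h0] := eqVneq u 0; first by rewrite linear0l re0 real_scalar0.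
  by rewrite real_scalar_re // ltW // neq0_dnorm_gt0.
by rewrite -ip_real mulrA mulrC re_real_scalarM re_conj re_real_scalar mulrC.
Qed.

Context {H : completeNormedModType F}.
Implicit Types (h u v : H).

Lemma hnorm_ge0 h : 0 <= hnorm h.
Proof. by rewrite /hnorm -(real_scalar_ge0 (F:=F)) real_scalar_re. Qed.

Lemma real_scalar_hnorm h : iota (hnorm h) = `|h|.
Proof. by rewrite real_scalar_re. Qed.

Lemma hnorm_eq0 h : hnorm h = 0 -> h = 0.
Proof.
move=> h0; apply/eqP; by rewrite -normr_eq0 -real_scalar_hnorm h0 real_scalar0.
Qed.

Lemma hnorm_triangle u v : hnorm (u + v) <= hnorm u + hnorm v.
Proof. by rewrite /hnorm -reD ler_re // ler_normD. Qed.

Lemma hnorm_opp u : hnorm (- u) = hnorm u.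
Proof. by rewrite /hnorm normrN. Qed.

Lemma hnorm_scale (c : F) u : hnorm (c *: u) = modulus c * hnorm u.
Proof.
by rewrite /hnorm /modulus normrZ -{1}real_scalar_modulus re_real_scalarM.
Qed.

(** Completeness, restated with real-valued distances. *)
Lemma hnorm_cauchy_cvg (x : nat -> H) :
  (forall eps : R, 0 < eps -> exists N, forall m n,
     (N <= m)%N -> (N <= n)%N -> hnorm (x m - x n) < eps) ->
  exists l, forall eps : R, 0 < eps -> exists N, forall n,
     (N <= n)%N -> hnorm (x n - l) < eps.
Proof.
move=> xC.
have reP (e : F) : 0 < e -> 0 < re e /\ iota (re e) = e.
  move=> e0; split; last by rewrite real_scalar_re // ltW.
  by have := ltr_re e0; rewrite re0.
have : cvg (x @ \oo).
  apply/cauchy_cvgP/cauchy_ballP => e e0; near_simpl.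
  have [r0 er] := reP _ e0; have [N xN] := xC _ r0.
  near=> m n; rewrite -ball_normE /= -real_scalar_hnorm -er ltr_real_scalar.
  by apply: xN; [near: m|near: n]; exists N.
move=> /cvg_ex[l xl]; exists l => eps eps0.
have e0 : 0 < iota eps.
  by rewrite real_scalar_gt0.
have /cvgrPdist_lt/(_ _ e0)[N _ xN] := xl.
exists N => n Nn; have := xN n Nn.
by rewrite /= -real_scalar_hnorm ltr_real_scalar -hnorm_opp opprB.
Unshelve. all: by end_near. Qed.

End HilbertSpaces.

(** * Representation of functionals and square roots of operators *)

Lemma inv_succ_small (R : realType) (eps : R) : 0 < eps ->
  exists N, forall n, (N <= n)%N -> n.+1%:R^-1 < eps.
Proof.
move=> e0; exists (Num.truncn eps^-1) => n Nn.
rewrite -[ltRHS]invrK ltf_pV2 ?posrE ?invr_gt0 // (lt_le_trans (truncnS_gt _)) //.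
by rewrite ler_nat ltnS.
Qed.

Lemma geometric_small (R : realType) (rho c eps : R) : 0 <= rho < 1 ->
  0 < eps -> exists N, forall n, (N <= n)%N -> c * rho ^+ n < eps.
Proof.
move=> /andP[r0 r1] e0.
have : rho ^+ n @[n --> \oo] --> (0 : R) by apply: cvg_expr; rewrite ger0_norm.
move=> /cvgrPdist_lt/(_ (eps / (`|c| + 1)))[|N _ HN].
  by rewrite divr_gt0 // ltr_wpDl.
exists N => n /HN /=; rewrite sub0r normrN ltr_pdivlMr ?ltr_wpDl // => Hn.
rewrite (le_lt_trans _ Hn) // (le_trans (ler_norm _)) // normrM mulrC.
by rewrite ler_wpM2l // lerDl.
Qed.

Lemma geometric_le0 (R : realType) (rho c x : R) : 0 <= rho < 1 ->
  (forall n, x <= c * rho ^+ n) -> x <= 0.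
Proof.
move=> r01 H; apply/ler_addgt0Pr => e e0; rewrite add0r.
have [N /(_ N (leqnn _)) HN] := geometric_small c r01 e0.
exact: le_trans (H N) (ltW HN).
Qed.

Section HilbertOperators.
Context {R : realType} {F : scalar_field R}.
Local Notation iota := (@real_scalar R F).
Context {H : completeNormedModType F}.
Context (hilbertH : hilbertian_norm (@hnorm R F H)).
Implicit Types (h u v w : H) (q : H -> R).

Let sqn h := hnorm h ^+ 2.
Let sqn_quadratic : quadratic sqn.
Proof. exact: hilbertian_norm_quadratic. Qed.

(** The functional [J u = q u - 2 * f u] is bounded from below.  By the
parallelogram law [q (x i - x j)] is controlled by how far [J (x i)] and
[J (x j)] are from the infimum, so minimizing sequences are Cauchy; at the limit
the derivative of [J] in each direction vanishes. *)
Lemma lax_milgram q (m M : R) (f : H -> R) (C : R) :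
  quadratic q -> 0 < m ->
  (forall u, m * hnorm u ^+ 2 <= q u) -> (forall u, q u <= M * hnorm u ^+ 2) ->
  (forall u v, f (u + v) = f u + f v) ->
  (forall a u, f (iota a *: u) = a * f u) ->
  (forall u, f u <= C * hnorm u) ->
  exists u, forall v, polar q u v = f v.
Proof.
move=> qq m0 qm qM fD fZ fC.
have q_ge0 u : 0 <= q u by case: qq.
pose J u := q u - 2 * f u; pose I := inf (range J).
have Jlb : has_lbound (range J).
  exists (- (C ^+ 2 / m)) => _ [u _ <-].
  have : 0 <= m * (hnorm u - C / m) ^+ 2 by rewrite mulr_ge0 ?sqr_ge0 // ltW.
  have -> : m * (hnorm u - C / m) ^+ 2
    = m * hnorm u ^+ 2 - 2 * (C * hnorm u) + C ^+ 2 / m.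
    by field; rewrite gt_eqF.
  by rewrite /J; have := qm u; have := fC u; lra.
have IJ u : I <= J u by apply: ge_inf => //; exists u.
have /choice[x xI] n : exists u, J u < I + n.+1%:R^-1.
  have hI : has_inf (range J) by split => //; exists (J 0); exists 0.
  have n0 : 0 < n.+1%:R^-1 :> R by rewrite invr_gt0.
  by have [_ [u _ <-] uI] := inf_adherent n0 hI; exists u.
have qx i j : q (x i - x j) <= 2 * i.+1%:R^-1 + 2 * j.+1%:R^-1.
  have [_ qpar _] := qq; have := qpar (x i) (x j).
  have := IJ (iota (2^-1) *: (x i + x j)).
  rewrite /J fZ fD quadratic_real //.
  have := xI i; have := xI j; rewrite /J.
  by set a := _ i.+1%:R; set b := _ j.+1%:R; lra.
have [l xl] : exists l, forall eps, 0 < eps ->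
    exists N, forall n, (N <= n)%N -> hnorm (x n - l) < eps.
  apply: hnorm_cauchy_cvg => eps e0.
  have [|N HN] := @inv_succ_small _ (m * eps ^+ 2 / 4) _.
    by rewrite divr_gt0 // mulr_gt0 // exprn_gt0.
  exists N => i j /HN iN /HN jN.
  rewrite -(ltr_pXn2r (n := 2)) ?nnegrE ?hnorm_ge0 // ?ltW //.
  by rewrite -(ltr_pM2l m0); have := qm (x i - x j); have := qx i j;
    move: iN jN; set a := _ i.+1%:R; set b := _ j.+1%:R; lra.
exists l => v; apply/eqP; rewrite -subr_eq0 -sqrf_eq0 eq_le sqr_ge0 andbT leNgt.
apply/negP; set D := _ ^+ 2 => D0.
(* [J (x n + t v)] exceeds the infimum for all [t], while [J (x n)] is close to
it: the discriminant in [t] bounds the derivative *)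
have dn n : (polar q (x n) v - f v) ^+ 2 <= q v * n.+1%:R^-1.
  apply: discriminant => // t.
  have := IJ (x n + iota t *: v).
  rewrite /J (quadraticD qq) (quadratic_real qq) polarC // polarZl // polarC // fD fZ.
  by have := xI n; rewrite /J; set a := _ n.+1%:R; lra.
have en n : polar q (l - x n) v ^+ 2 <= q v * (`|M| * hnorm (x n - l) ^+ 2).
  rewrite mulrC (le_trans (polar_CauchySchwarz qq _ _)) // ler_wpM2r //.
  rewrite (le_trans (qM _)) // -opprB hnorm_opp ler_wpM2r ?sqr_ge0 // ler_norm //.
have Dn n : D <= 2 * q v * (n.+1%:R^-1 + `|M| * hnorm (x n - l) ^+ 2).
  have -> : D = ((polar q (x n) v - f v) + polar q (l - x n) v) ^+ 2.
    by rewrite /D polarDl // polarNl //; congr (_ ^+ 2); ring.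
  have : 0 <= ((polar q (x n) v - f v) - polar q (l - x n) v) ^+ 2.
    exact: sqr_ge0.
  by have := dn n; have := en n; set a := _ n.+1%:R; lra.
pose A := 8 * (q v + 1) * (`|M| + 1).
have A0 : 0 < A by rewrite !mulr_gt0 // ltr_wpDl.
have [N1 H1] := inv_succ_small (divr_gt0 D0 A0).
have [|N2 H2] := xl (Num.sqrt (D / A)); first by rewrite sqrtr_gt0 divr_gt0.
pose n := maxn N1 N2.
have {}H1 := H1 n (leq_maxl _ _); have {}H2 := H2 n (leq_maxr _ _).
have {H2} : hnorm (x n - l) ^+ 2 < D / A.
  by rewrite -(ltr_pXn2r (n := 2)) ?nnegrE ?hnorm_ge0 ?sqrtr_ge0 // sqr_sqrtr // divr_ge0 ?ltW in H2.
move: H1 (Dn n); set a := n.+1%:R^-1; set b := hnorm _ ^+ 2 => H1 Dab H2.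
set d := D / A in H1 H2.
have Dd : D = 8 * ((q v + 1) * ((1 + `|M|) * d)).
  have -> : D = A * d by rewrite mulrC divfK // gt_eqF.
  by rewrite /A; ring.
have ab : a + `|M| * b <= (1 + `|M|) * d.
  rewrite mulrDl mul1r lerD //; first exact: ltW.
  by rewrite ler_wpM2l // ltW.
have ab0 : 0 <= a + `|M| * b 
  by rewrite /a /b addr_ge0 ?invr_ge0 // mulr_ge0 // sqr_ge0.
have : q v * (a + `|M| * b) <= (q v + 1) * ((1 + `|M|) * d).
  by rewrite ler_pM // lerDl.
by lra.
Qed.

Let linD (f : H -> H) u v : linear f -> f (u + v) = f u + f v.
Proof. by move=> fl; rewrite -[u in LHS]scale1r fl scale1r. Qed.

Let lin0 (f : H -> H) : linear f -> f 0 = 0.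
Proof. by move=> /linD fD; apply: (addrI (f 0)); rewrite -fD !addr0. Qed.

Let linZ (f : H -> H) c u : linear f -> f (c *: u) = c *: f u.
Proof. by move=> fl; rewrite -[c *: u]addr0 fl lin0 // addr0. Qed.

Let linN (f : H -> H) u : linear f -> f (- u) = - f u.
Proof. by move=> fl; rewrite -scaleN1r linZ // scaleN1r. Qed.

Let linB (f : H -> H) u v : linear f -> f (u - v) = f u - f v.
Proof. by move=> fl; rewrite linD // linN. Qed.

Lemma hnorm_geometric_cvg (Y : nat -> H -> H) (rho : R) : 0 <= rho < 1 ->
  (forall n h, hnorm (Y n.+1 h - Y n h) <= rho ^+ n * hnorm h) ->
  exists Z, forall n h, hnorm (Y n h - Z h) <= (1 - rho)^-1 * rho ^+ n * hnorm h.
Proof.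
move=> r01 Ydiff; have /andP[r0 r1] := r01.
have s0 : 0 < 1 - rho by rewrite subr_gt0.
have Ynk n k h : hnorm (Y (n + k)%N h - Y n h)
    <= (1 - rho)^-1 * (rho ^+ n - rho ^+ (n + k)) * hnorm h.
  elim: k => [|k IH].
    by rewrite addn0 !subrr mulr0 mul0r /hnorm normr0 re0.
  rewrite addnS -[_ - Y n h](subrKA (Y (n + k)%N h)).
  rewrite (le_trans (hnorm_triangle _ _)) //.
  rewrite (le_trans (lerD (Ydiff _ _) IH)) //.
  rewrite -mulrDl ler_wpM2r ?hnorm_ge0 // -(ler_pM2l s0).
  rewrite mulrDr !mulrA divff ?gt_eqF // exprS; lra.
have Yle n k h : (n <= k)%N ->
    hnorm (Y k h - Y n h) <= (1 - rho)^-1 * rho ^+ n * hnorm h.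
  move=> /subnKC <-; rewrite (le_trans (Ynk _ _ _)) //.
  rewrite ler_wpM2r ?hnorm_ge0 // ler_wpM2l ?invr_ge0 ?(ltW s0) //.
  by rewrite lerBlDr lerDl exprn_ge0.
have /choice[Z YZ] h : exists l, forall eps, 0 < eps ->
    exists N, forall n, (N <= n)%N -> hnorm (Y n h - l) < eps.
  apply: hnorm_cauchy_cvg => eps e0.
  have [|N HN] := @geometric_small _ _ ((1 - rho)^-1 * hnorm h) (eps / 2) r01.
    by rewrite divr_gt0.
  exists N => i j iN jN; rewrite -[_ - Y j h](subrKA (Y N h)).
  rewrite (le_lt_trans (hnorm_triangle _ _)) // -[Y N h - Y j h]opprB hnorm_opp.
  have := HN N (leqnn _); have := Yle N i h iN; have := Yle N j h jN.
  by rewrite [_ * hnorm h]mulrAC; lra.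
exists Z => n h; apply/ler_addgt0Pr => e e0.
have [N HN] := YZ h _ e0.
rewrite -[_ - Z h](subrKA (Y (maxn N n) h)) (le_trans (hnorm_triangle _ _)) //.
rewrite lerD //; last by rewrite ltW // HN // leq_maxl.
by rewrite -opprB hnorm_opp Yle // leq_maxr.
Qed.

Lemma hnorm_polar_le u v : `|polar sqn u v| <= hnorm u * hnorm v.
Proof.
rewrite -(ler_pXn2r (n := 2)) ?nnegrE ?mulr_ge0 ?hnorm_ge0 //.
rewrite real_normK ?num_real // [leRHS]exprMn.
exact: (polar_CauchySchwarz sqn_quadratic).
Qed.

Let sadj (f : H -> H) := forall u v, polar sqn (f u) v = polar sqn u (f v).

(** If [rho] satisfies [(theta + rho^2) / 2 <= rho < 1], the map
[Y |-> (X + Y^2) / 2] preserves the operators of norm at most [rho] and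
contracts distances by the factor [rho] there. *)
Lemma sqrt_iteration (X : H -> H) (theta rho : R) :
  linear X -> sadj X -> 0 <= theta -> 0 <= rho < 1 ->
  theta + rho ^+ 2 <= 2 * rho ->
  (forall h, hnorm (X h) <= theta * hnorm h) ->
  exists Y : H -> H, [/\ linear Y, sadj Y,
    forall h, hnorm (Y h) <= rho * hnorm h
    & forall h, X h + Y (Y h) = Y h + Y h].
Proof.
move=> Xl Xa t0 r01 tr Xn; have /andP[r0 r1] := r01.
pose half : F := iota (2^-1).
have hZ h : hnorm (half *: h) = 2^-1 * hnorm h.
  by rewrite hnorm_scale modulus_real_scalar ger0_norm.
pose Y := fix Y n h := if n is n'.+1 then half *: (X h + Y n' (Y n' h)) else 0.
have Yl n : linear (Y n).
  elim: n => [|n IH] a u v /=; first by rewrite scaler0 addr0.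
  by rewrite Xl !IH addrACA -scalerDr (scalerDr half (_ *: _)) !scalerA mulrC.
have Yn n h : hnorm (Y n h) <= rho * hnorm h.
  elim: n h => [|n IH] h /=.
    by rewrite /hnorm normr0 re0 mulr_ge0 // hnorm_ge0.
  rewrite hZ (le_trans (ler_wpM2l _ (hnorm_triangle _ _))) //.
  have := IH (Y n h); have := ler_wpM2l r0 (IH h); have := Xn h.
  by have := ler_wpM2r (hnorm_ge0 h) tr; lra.
have Ya n : sadj (Y n).
  elim: n => [|n IH] u v /=.
    by rewrite /polar !add0r !addr0 subr0 quadraticN // !subrr.
  rewrite polarZl // polarDl // Xa !IH polarC // [RHS]polarC // polarZl //.
  by rewrite polarDl // ![polar _ _ u]polarC.
have Yd n h : hnorm (Y n.+1 h - Y n h) <= rho ^+ n * hnorm h.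
  elim: n h => [|n IH] h.
    rewrite [Y 0%N h]/= subr0 expr0 mul1r (le_trans (Yn 1%N h)) //.
    by rewrite ler_piMl ?hnorm_ge0 // ltW.
  have -> : Y n.+2 h - Y n.+1 h
    = half *: (Y n.+1 (Y n.+1 h - Y n h) + (Y n.+1 (Y n h) - Y n (Y n h))).
    rewrite (linB _ _ (Yl _)) addrA subrK -/Y [LHS]/= -scalerBr.
    by rewrite opprD addrACA subrr add0r.
  rewrite hZ (le_trans (ler_wpM2l _ (hnorm_triangle _ _))) //.
  have := Yn n.+1 (Y n.+1 h - Y n h); have := ler_wpM2l r0 (IH h).
  have := IH (Y n h); have := ler_wpM2l (exprn_ge0 n r0) (Yn n h).
  by rewrite exprS; lra.
have [Z YZ] := hnorm_geometric_cvg r01 Yd.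
set E := (1 - rho)^-1 in YZ.
(* an element whose norm is at most a multiple of [rho ^+ n] vanishes *)
have small0 (z : H) c : (forall n, hnorm z <= c * (E * rho ^+ n)) -> z = 0.
  move=> Hz; apply: hnorm_eq0; apply/eqP; rewrite eq_le hnorm_ge0 andbT.
  by apply: (geometric_le0 (c := c * E) r01) => n; rewrite -mulrA.
have Zl : linear Z.
  move=> a u v; apply/eqP; rewrite -subr_eq0; apply/eqP.
  apply: (@small0 _ (hnorm (a *: u + v) + modulus a * hnorm u + hnorm v)) => n.
  have -> : Z (a *: u + v) - (a *: Z u + Z v)
    = - (Y n (a *: u + v) - Z (a *: u + v)) + (a *: (Y n u - Z u) + (Y n v - Z v)).
    by rewrite Yl opprB scalerBr [a *: _ - _ + _]addrACA -opprD addrA subrK.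
  rewrite (le_trans (hnorm_triangle _ _)) // hnorm_opp [leRHS]mulrC !mulrDr -addrA.
  rewrite lerD //.
  rewrite (le_trans (hnorm_triangle _ _)) // lerD ?YZ // hnorm_scale mulrCA.
  by rewrite ler_wpM2l ?modulus_ge0 // YZ.
have Zn h : hnorm (Z h) <= rho * hnorm h.
  rewrite -subr_le0; apply: (geometric_le0 (c := E * hnorm h) r01) => n.
  rewrite lerBlDr -[Z h](subrK (Y n h)) (le_trans (hnorm_triangle _ _)) //.
  by rewrite lerD // -opprB hnorm_opp mulrAC YZ.
exists Z; split=> // [u v|h].
  apply/eqP; rewrite -subr_eq0 -normr_le0.
  apply: (geometric_le0 (c := 2 * E * hnorm u * hnorm v) r01) => n.
  have -> : polar sqn (Z u) v - polar sqn u (Z v)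
    = polar sqn (Y n v - Z v) u - polar sqn (Y n u - Z u) v.
    rewrite !polarDl // !polarNl // Ya [polar _ (Z v) u]polarC //.
    by rewrite [polar _ v (Y n u)]polarC //; lra.
  rewrite (le_trans (ler_normB _ _)) //.
  have := hnorm_polar_le (Y n v - Z v) u; have := hnorm_polar_le (Y n u - Z u) v.
  have := ler_wpM2r (hnorm_ge0 u) (YZ n v).
  have := ler_wpM2r (hnorm_ge0 v) (YZ n u).
  by lra.
apply/eqP; rewrite -subr_eq0; apply/eqP; apply: (@small0 _ (4 * hnorm h)) => n.
have -> : X h + Z (Z h) - (Z h + Z h)
    = (Y n.+1 h - Z h) + (Y n.+1 h - Z h)
      - (Y n (Y n h - Z h) + (Y n (Z h) - Z (Z h))).
  rewrite (linB _ _ (Yl _)) subrKA [in RHS]addrACA.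
  have -> : Y n.+1 h + Y n.+1 h = X h + Y n (Y n h).
    rewrite -scalerDl -real_scalarD (_ : 2^-1 + 2^-1 = 1) ?real_scalar1 ?scale1r //.
    by lra.
  by rewrite opprB -opprD [RHS]addrAC [X h + Y n _ + _]addrACA subrr addr0.
rewrite (le_trans (hnorm_triangle _ _)) // hnorm_opp.
have := hnorm_triangle (Y n.+1 h - Z h) (Y n.+1 h - Z h).
have := hnorm_triangle (Y n (Y n h - Z h)) (Y n (Z h) - Z (Z h)).
have := YZ n.+1 h; have := YZ n (Z h).
have := Yn n (Y n h - Z h).
have := ler_wpM2l r0 (YZ n h).
have E0 : 0 <= E by rewrite invr_ge0 subr_ge0 ltW.
have En0 : 0 <= E * rho ^+ n by rewrite mulr_ge0 // exprn_ge0.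
have := ler_wpM2l En0 (Zn h).
have := ler_wpM2r (mulr_ge0 En0 (hnorm_ge0 h)) (ltW r1).
by rewrite exprS; lra.
Qed.

Let riesz_eq u w : (forall v, polar sqn u v = polar sqn w v) -> u = w.
Proof.
move=> uw; apply/eqP; rewrite -subr_eq0; apply/eqP/hnorm_eq0/eqP.
rewrite -sqrf_eq0 -[_ ^+ 2]/(sqn (u - w)) -(polar_diag sqn_quadratic).
by rewrite polarDl // polarNl // uw subrr.
Qed.

(** With [S] the operator representing [q], the operator [X = 1 - S / K^2] has norm
at most [theta = 1 - 1 / K^2], and [rho = 1 - 1 / K] is exactly the fixed point
of [r |-> (theta + r^2) / 2] below 1.  The resulting [A = K (1 - Y)] satisfies
[hnorm h ^+ 2 <= polar (A h) h], so that [lax_milgram] inverts it. *)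
Theorem quadratic_square_root q (K : R) : quadratic q -> 1 <= K ->
  (forall h, hnorm h ^+ 2 <= q h) -> (forall h, q h <= (K * hnorm h) ^+ 2) ->
  exists A B : {linear H -> H}, [/\ cancel A B, cancel B A
    & forall h, hnorm (A h) ^+ 2 = q h].
Proof.
move=> qq K1 q1 qK.
have K0 : 0 < K by rewrite (lt_le_trans ltr01).
have q_ge0 u : 0 <= q u by case: qq.
have /choice[S SE] h : exists s, forall v, polar sqn s v = polar q h v.
  apply: (@lax_milgram sqn 1 1 (polar q h) (K ^+ 2 * hnorm h)) => // [u|u|u v|a u|u].
  - by rewrite mul1r.
  - by rewrite mul1r.
  - by rewrite ![polar q h _]polarC // polarDl.
  - by rewrite ![polar q h _]polarC // polarZl.
  rewrite (le_trans (ler_norm _)) //.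
  have C0 : 0 <= K ^+ 2 * hnorm h * hnorm u.
    by rewrite mulr_ge0 ?hnorm_ge0 // mulr_ge0 ?hnorm_ge0 ?sqr_ge0.
  rewrite -(ler_pXn2r (n := 2)) ?nnegrE //.
  rewrite real_normK ?num_real // (le_trans (polar_CauchySchwarz qq _ _)) //.
  rewrite (le_trans (ler_pM _ _ (qK h) (qK u))) //.
  by rewrite le_eqVlt; apply/orP; left; apply/eqP; ring.
have Sl : linear S.
  move=> c u w; apply: riesz_eq => v; rewrite SE polarDl // polarDl // SE.
  congr (_ + _); have [->|c0] := eqVneq c 0.
    by rewrite !scale0r /polar !add0r !quadraticN // !subrr.
  (* write [v = c *: (c^-1 *: v)] and factor [|c|^2] out of both sides *)
  by rewrite -[v](scalerKV c0) !polarZZ // SE.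
pose theta := 1 - K^-1 ^+ 2.
have K10 : 0 < K^-1 by rewrite invr_gt0.
have K11 : K^-1 <= 1 by rewrite invf_le1.
have theta0 : 0 <= theta by rewrite subr_ge0 expr_le1 // ltW.
pose x h := sqn h - K^-1 ^+ 2 * q h.
have xq : quadratic x.
  have [s0 spar sZ] := sqn_quadratic; have [_ qpar qZ] := qq.
  split=> [u|u v|c u]; last by rewrite /x sZ qZ; ring.
    by rewrite subr_ge0 exprVn ler_pdivrMl ?exprn_gt0 // -exprMn.
    by rewrite /x addrACA -opprD -mulrDr spar qpar; ring.
have x_le h : x h <= theta * sqn h.
  rewrite /x /theta mulrBl mul1r lerD2l lerN2 ler_wpM2l ?sqr_ge0 //; exact: q1.
pose X h := h - iota (K^-1 ^+ 2) *: S h.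
have XE u v : polar sqn (X u) v = polar x u v.
  by rewrite /X polarDl // polarNl // polarZl // SE /polar /x; lra.
have Xl : linear X.
  move=> c u v; rewrite /X Sl scalerDr scalerBr scalerA mulrC -scalerA.
  by rewrite opprD addrACA.
have Xa u v : polar sqn (X u) v = polar sqn u (X v).
  by rewrite XE polarC // -XE polarC.
have Xn h : hnorm (X h) <= theta * hnorm h.
  have x_ge0 u : 0 <= x u by case: xq.
  have : sqn (X h) ^+ 2 <= theta ^+ 2 * (sqn h * sqn (X h)).
    rewrite -{1}(polar_diag sqn_quadratic) XE.
    rewrite (le_trans (polar_CauchySchwarz xq _ _)) //.
    by rewrite (le_trans (ler_pM _ _ (x_le h) (x_le (X h)))) //; lra.
  rewrite /sqn; have := hnorm_ge0 (X h); have := hnorm_ge0 h.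
  move: (hnorm (X h)) (hnorm h) => a b b0; rewrite le_eqVlt => /orP[/eqP <- _|a0].
    by rewrite mulr_ge0.
  rewrite mulrA -exprMn [_ ^+ 2 ^+ 2]expr2 ler_pM2r ?exprn_gt0 //.
  by rewrite ler_pXn2r ?nnegrE ?mulr_ge0 // ltW.
pose rho := 1 - K^-1.
have rho01 : 0 <= rho < 1 by rewrite subr_ge0 K11 gtrBl K10.
have [|Y [Yl Ya Yn YE]] := sqrt_iteration Xl Xa theta0 rho01 _ Xn.
  by rewrite /theta /rho; lra.
pose A h := iota K *: (h - Y h).
have Al : linear A.
  move=> c u v; rewrite /A Yl opprD addrACA -scalerBr scalerDr scalerA mulrC.
  by rewrite -scalerA.
have AE u v : polar sqn (A u) v = K * (polar sqn u v - polar sqn (Y u) v).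
  by rewrite /A polarZl // polarDl // polarNl.
have Aa u v : polar sqn (A u) v = polar sqn u (A v).
  rewrite AE [RHS]polarC // AE Ya [polar _ v u]polarC //.
  by rewrite [polar _ (Y v) u]polarC.
have Asq h : hnorm (A h) ^+ 2 = q h.
  rewrite -[LHS]/(sqn (A h)) -(polar_diag sqn_quadratic) AE.
  rewrite polarC // AE [polar _ (Y h) (A h)]polarC // AE.
  rewrite -(polar_diag qq) -SE [polar _ h (Y h)]polarC // [polar _ (Y h) (Y h)]Ya.
  have /(congr1 (fun z => polar sqn z h)) := YE h; rewrite /= !polarDl //.
  rewrite polarNl // polarZl // [polar _ (Y (Y h)) h]polarC // => E.
  have -> : polar sqn (S h) h = K ^+ 2 * (K^-1 ^+ 2 * polar sqn (S h) h).
    by rewrite mulrA -exprMn divff ?gt_eqF // expr1n mul1r.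
  rewrite (_ : K^-1 ^+ 2 * _ = polar sqn h h + polar sqn h (Y (Y h))
    - 2 * polar sqn (Y h) h); last by lra.
  by ring.
pose a h := polar sqn (A h) h.
have aE h : a h = K * (sqn h - polar sqn (Y h) h).
  by rewrite /a AE polar_diag.
have Yh h : `|polar sqn (Y h) h| <= rho * sqn h.
  rewrite (le_trans (hnorm_polar_le _ _)) // /sqn expr2 mulrA.
  by rewrite ler_wpM2r ?hnorm_ge0.
have a_ge h : 1 * hnorm h ^+ 2 <= a h.
  rewrite aE -ler_pdivrMl //; have := Yh h; rewrite ler_norml => /andP[_].
  by rewrite /rho /sqn; lra.
have aD u v : a (u + v) = a u + 2 * polar sqn (A u) v + a v.
  rewrite /a linD // polarDl // ![polar _ _ (_ + _)]polarC // !polarDl //.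
  rewrite [polar _ v (A u)]polarC // -Aa polarC // [polar _ v (A v)]polarC //.
  by rewrite [polar _ u (A u)]polarC // -[polar _ u (A v)]Aa; lra.
have aB u v : a (u - v) = a u - 2 * polar sqn (A u) v + a v.
  have -> : a (u - v) = a u + 2 * polar sqn (A u) (- v) + a (- v) by exact: aD.
  have -> : a (- v) = a v.
    by rewrite /a linN // polarNl // polarC // polarNl // polarC // opprK.
  by rewrite polarC // polarNl // polarC //; lra.
have aq : quadratic a.
  split=> [u|u v|c u].
  - by apply: le_trans (a_ge u); rewrite mul1r sqr_ge0.
  - by rewrite aD aB; lra.
  by rewrite /a linZ // polarZZ.
have aA u v : polar a u v = polar sqn (A u) v.
  by rewrite /polar aD aB -/(polar _ _ _); lra.
have /choice[B BE] k : exists u, A u = k.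
  have [|u|u v|c u|u|u uE] := @lax_milgram a 1 (2 * K) (polar sqn k) (hnorm k) aq _ a_ge.
  - by [].
  - rewrite aE; have := Yh u; rewrite ler_norml => /andP[yu _].
    have : K * (sqn u - polar sqn (Y u) u) <= K * (2 * sqn u).
      by rewrite ler_pM2l //; have := sqr_ge0 (hnorm u);
        have := mulr_ge0 (ltW K10) (sqr_ge0 (hnorm u)); rewrite /rho -/(sqn u) in yu *; lra.
    by rewrite /sqn; lra.
  - by rewrite ![polar _ k _]polarC // polarDl.
  - by rewrite ![polar _ k _]polarC // polarZl.
  - by rewrite (le_trans (ler_norm _)) // hnorm_polar_le.
  by exists u; apply: riesz_eq => v; rewrite -aA uE.
have Ainj u v : A u = A v -> u = v.
  move=> uv; apply/eqP; rewrite -subr_eq0; apply/eqP/hnorm_eq0/eqP.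
  rewrite -sqrf_eq0 eq_le sqr_ge0 andbT (le_trans (q1 _)) // -Asq linB // uv.
  by rewrite subrr /hnorm normr0 re0 expr0n.
have Bl : linear B by move=> c u v; apply: Ainj; rewrite Al !BE.
pose Alin : {linear H -> H} := HB.pack A (GRing.isLinear.Build _ _ _ _ A Al).
pose Blin : {linear H -> H} := HB.pack B (GRing.isLinear.Build _ _ _ _ B Bl).
by exists Alin, Blin; split => // h; apply: Ainj; rewrite BE.
Qed.

End HilbertOperators.

(** * Invariant means on bounded functions *)

Section InvariantMean.
Context {R : realType}.
Implicit Types (f g : R -> R) (s : seq R) (x a b c : R).

Definition is_bounded f := exists B, forall x, `|f x| <= B.

Definition invariant_mean (m : (R -> R) -> R) : Prop :=
  [/\ forall f g, is_bounded f -> is_bounded g -> m (fun x => f x + g x) = m f + m g,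
      forall c f, is_bounded f -> m (fun x => c * f x) = c * m f,
      forall f g, is_bounded f -> is_bounded g -> (forall x, f x <= g x) -> m f <= m g,
      m (fun=> 1) = 1
    & forall b f, is_bounded f -> m (fun x => f (x + b)) = m f].

(** The average of [f] over the points [x + j1 a1 + ... + jk ak] with
[0 <= j <= n], where [s = [:: a1; ...; ak]]. *)
Fixpoint average s n f x : R :=
  if s is a :: s' then
    n.+1%:R^-1 * \sum_(j < n.+1) average s' n f (x + j%:R * a)
  else f x.

Lemma averageD s n f g x :
  average s n (fun y => f y + g y) x = average s n f x + average s n g x.
Proof.
elim: s x => //= a s IH x; by rewrite (eq_bigr _ (fun j _ => IH _)) big_split mulrDr.
Qed.

Lemma averageZ s n c f x :
  average s n (fun y => c * f y) x = c * average s n f x.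
Proof.
elim: s x => //= a s IH x; by rewrite (eq_bigr _ (fun j _ => IH _)) -mulr_sumr mulrCA.
Qed.

Lemma average1 s n x : average s n (fun=> 1) x = 1.
Proof.
elim: s x => //= a s IH x; rewrite (eq_bigr (fun=> 1)) //.
by rewrite sumr_const card_ord mulVf // pnatr_eq0.
Qed.

Lemma average_le s n f g x : (forall y, f y <= g y) ->
  average s n f x <= average s n g x.
Proof.
by move=> fg; elim: s x => //= a s IH x; rewrite ler_wpM2l ?invr_ge0 // ler_sum.
Qed.

Lemma average_shift s n f b x :
  average s n (fun y => f (y + b)) x = average s n f (x + b).
Proof.
elim: s x => //= a s IH x; congr *%R; apply: eq_bigr => j _.
by rewrite IH addrAC.
Qed.

Lemma average_norm s n f B x : (forall y, `|f y| <= B) ->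
  `|average s n f x| <= B.
Proof.
move=> fB; elim: s x => //= a s IH x.
rewrite normrM ger0_norm ?invr_ge0 // ler_pdivrMl ?ltr0Sn //.
rewrite (le_trans (ler_norm_sum _ _ _)) // (le_trans (ler_sum _ (fun j _ => IH _))) //.
by rewrite sumr_const card_ord mulr_natl.
Qed.

(** Along the direction [b] the average is over an arithmetic progression of step
[b]: translating by [b] changes only its two end terms. *)
Lemma average_invariant s n f B b x : (forall y, `|f y| <= B) -> b \in s ->
  `|average s n f (x + b) - average s n f x| <= n.+1%:R^-1 * (2 * B).
Proof.
move=> fB; elim: s x => //= a s IH x; rewrite inE => /predU1P[<-{IH a}|bs].
  rewrite -mulrBr -sumrB normrM ger0_norm ?invr_ge0 // ler_wpM2l ?invr_ge0 //.
  rewrite (eq_bigr (fun j : 'I_n.+1 => average s n f (x + j.+1%:R * b)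
    - average s n f (x + j%:R * b))); last first.
    by move=> j _; rewrite -[j.+1]add1n natrD mulrDl mul1r addrA.
  rewrite -(big_mkord xpredT (fun j => average s n f (x + j.+1%:R * b)
    - average s n f (x + j%:R * b))).
  rewrite (telescope_sumr (fun j => average s n f (x + j%:R * b))) //.
  rewrite (le_trans (ler_normB _ _)) // mulr2n mulrDl mul1r.
  by rewrite lerD // average_norm.
rewrite -mulrBr -sumrB normrM ger0_norm ?invr_ge0 // ler_pdivrMl ?ltr0Sn //.
rewrite (le_trans (ler_norm_sum _ _ _)) //.
apply: (@le_trans _ _ (\sum_(j < n.+1) n.+1%:R^-1 * (2 * B))).
  by apply: ler_sum => j _; rewrite addrAC IH.
by rewrite sumr_const card_ord -[leLHS]mulr_natl.
Qed.

Let ultra_fmap (T S : Type) (h : T -> S) (U : set_system T) :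
  UltraFilter U -> UltraFilter (h @ U).
Proof.
move=> UU; split; first exact: fmap_proper_filter.
move=> G GF UG; apply/seteqP; split=> // A GA.
have [//|UA] := in_ultra_setVsetC (h @^-1` A) UU.
have GA' : G (~` A) by apply: UG.
have : G (A `&` ~` A) by exact: filterI.
by rewrite setICr => /filter_not_empty.
Qed.

(* the filter of properties that hold for every finite set of directions and
every length, once both are large enough *)
Let large (A : set (seq R * nat)) := exists s0 n0,
  forall s n, {subset s0 <= s} -> (n0 <= n)%N -> A (s, n).

Let large_filter : ProperFilter large.
Proof.
apply: Build_ProperFilter.
  by move=> [s0 [n0 H]]; apply: (H s0 n0).
split=> [|A B [s1 [n1 H1]] [s2 [n2 H2]]|A B AB [s0 [n0 H0]]].
- by exists [::], 0%N.
- exists (s1 ++ s2), (maxn n1 n2) => s n ss; rewrite geq_max => /andP[n1n n2n].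
  split; [apply: H1|apply: H2] => // z zs; apply: ss; rewrite mem_cat zs ?orbT//.
- by exists s0, n0 => s n ? ?; apply/AB/H0.
Qed.

(** The limit of the averages at 0 along an ultrafilter: it is invariant under each
translation because each translation eventually belongs to the directions. *)
Theorem exists_invariant_mean : exists m, invariant_mean m.
Proof.
have [U [UU lU]] := ultraFilterLemma large_filter.
pose av f (i : seq R * nat) : R := average i.1 i.2 f 0.
pose m f := lim (av f @ U).
have mP f : is_bounded f -> av f @ U --> m f.
  move=> [B fB]; apply/cvg_ex.
  have := @segment_compact R (- B) B; rewrite compact_ultra => /(_ (av f @ U) (ultra_fmap _ UU)).
  case=> [|l [_ ul]]; last by exists l.
  apply: (@filterS _ U _ setT); last exact: filterT.
  move=> i _ /=; rewrite in_itv /= -ler_norml.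
  exact: average_norm.
have bD f g : is_bounded f -> is_bounded g -> is_bounded (fun x => f x + g x).
  move=> [B fB] [C gC]; exists (B + C) => x.
  by rewrite (le_trans (ler_normD _ _)) // lerD.
have bZ c f : is_bounded f -> is_bounded (fun x => c * f x).
  by move=> [B fB]; exists (`|c| * B) => x; rewrite normrM ler_wpM2l.
exists m; split.
- move=> f g bf bg; apply: (cvg_unique _ (mP _ (bD _ _ bf bg))) => //.
  rewrite (_ : av _ = fun i => av f i + av g i); first exact: cvgD (mP _ bf) (mP _ bg).
  by apply/funext => i; rewrite /av averageD.
- move=> c f bf; apply: (cvg_unique _ (mP _ (bZ c _ bf))) => //.
  rewrite (_ : av _ = fun i => c * av f i); first exact: cvgM (cvg_cst c) (mP _ bf).
  by apply/funext => i; rewrite /av averageZ.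
- move=> f g bf bg fg; rewrite -subr_ge0.
  apply: (cvgr_to_ge (cvgB (mP _ bg) (mP _ bf))).
  by apply: nearW => i; rewrite subr_ge0 average_le.
- rewrite /m (_ : av _ = fun=> 1); first exact: lim_cst.
  by apply/funext => i; rewrite /av average1.
move=> b f [B fB].
have bf : is_bounded f by exists B.
have bfb : is_bounded (fun x => f (x + b)) by exists B.
apply/eqP; rewrite -subr_eq0 -normr_le0; apply/ler_addgt0Pr => e e0.
rewrite add0r.
have dcvg : (fun i => av (fun x => f (x + b)) i - av f i) @ U
    --> m (fun x => f (x + b)) - m f.
  exact: cvgB (mP _ bfb) (mP _ bf).
have B0 : 0 <= B by apply: le_trans (fB 0).
apply: (cvgr_to_le (cvg_norm dcvg)); apply: lU; exists [:: b], (Num.truncn (2 * B / e)) => s n bs nn.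
rewrite /av /= average_shift (le_trans (average_invariant n 0 fB _)) //.
  by apply: bs; rewrite inE.
rewrite mulrC ler_pdivrMr ?ltr0Sn // -ler_pdivrMl // mulrC.
by rewrite (le_trans (ltW (truncnS_gt _))) // ler_nat ltnS.
Qed.

End InvariantMean.

(** * Averaging over one period *)

Section Residue.
Context {R : realType} (tau : R) (tau0 : 0 < tau).
Implicit Types (x s : R).

(** The representative of [x] modulo [tau] in [[- tau, 0[]. *)
Definition residue x : R := x - tau * (Num.floor ((x + tau) / tau))%:~R.

Lemma residue_itv x : - tau <= residue x < 0.
Proof.
rewrite /residue; set k := Num.floor _.
have k1 : k%:~R * tau <= x + tau by rewrite -ler_pdivlMr // floor_le.
have k2 : x + tau < (k%:~R + 1) * tau.
  by rewrite -ltr_pdivrMr // -[1]/(1%:~R) -intrD floorD1_gt.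
by apply/andP; split; lra.
Qed.

Lemma residue_unique x (k : int) : - tau <= x - tau * k%:~R < 0 ->
  residue x = x - tau * k%:~R.
Proof.
move=> /andP[h1 h2]; rewrite /residue; congr (_ - _ * _%:~R).
apply: floor_def; rewrite intrD ler_pdivlMr // ltr_pdivrMr //.
by apply/andP; split; lra.
Qed.

Lemma residue_shift x s : 0 <= s ->
  exists j : nat, residue x + s = residue (x + s) + j%:R * tau.
Proof.
move=> s0; have := residue_itv x; have := residue_itv (x + s).
rewrite /residue; set k := Num.floor _; set k' := Num.floor _.
move=> /andP[b1 b2] /andP[a1 a2].
have : k'%:~R < k%:~R + 1 :> R by rewrite -(ltr_pM2r tau0); lra.
rewrite -[1]/(1%:~R) -intrD ltr_int ltzD1 -subr_ge0.
case E : (k - k') => [j|//] _; exists j.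
have -> : (j%:R : R) = k%:~R - k'%:~R by rewrite -intrB E pmulrn.
by ring.
Qed.

(** The translates of the window [[- l, 0[] by [0, l, ..., (n - 1) l] cover a period,
hence the sum of their indicators is at least 1 everywhere. *)
Lemma window_mean (m : (R -> R) -> R) (l : R) (n : nat) : invariant_mean m ->
  0 < l <= tau -> tau <= n%:R * l ->
  1 <= n%:R * m (fun x => (- l <= residue x)%R%:R).
Proof.
move=> [mD mZ mle m1 mshift] /andP[l0 lt] tn.
pose i x : R := (- l <= residue x)%R%:R.
have ib : is_bounded i by exists 1 => x; rewrite /i; case: (- l <= _); rewrite ?normr1 ?normr0.
have sb k : is_bounded (fun x => \sum_(j < k) i (x + j%:R * l)) /\
    m (fun x => \sum_(j < k) i (x + j%:R * l)) = k%:R * m i.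
  elim: k => [|k [kb IH]].
    split; first by exists 0 => x; rewrite big_ord0 normr0.
    rewrite mul0r -[RHS](mul0r (m i)) -mZ //; congr m; apply/funext => x.
    by rewrite big_ord0 mul0r.
  have E : (fun x => \sum_(j < k.+1) i (x + j%:R * l))
      = (fun x => \sum_(j < k) i (x + j%:R * l) + i (x + k%:R * l)).
    by apply/funext => x; rewrite big_ord_recr.
  have ibk : is_bounded (fun x => i (x + k%:R * l)) by case: ib => B iB; exists B.
  rewrite E; split.
    case: kb ibk => B hB [C hC]; exists (B + C) => x.
    by rewrite (le_trans (ler_normD _ _)) // lerD.
  by rewrite mD // IH mshift // -natr1 mulrDl mul1r.
have [nb <-] := sb n; rewrite -[leLHS]m1; apply: mle => //; first by exists 1 => x; rewrite normr1.
move=> x; have /andP[x1 x2] := residue_itv x.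
have n0 : (0 < n)%N.
  by rewrite lt0n; apply: contraTneq tn => ->; rewrite mul0r -ltNge.
have exj : exists j, - residue x <= j.+1%:R * l.
  by exists n.-1; rewrite prednK //; lra.
pose j := ex_minn exj; have jE : j = ex_minn exj by [].
move: jE; case: ex_minnP => k kl kmin _ {j}.
have kn : (k < n)%N.
  by rewrite -(prednK n0) ltnS kmin // prednK //; lra.
have kx : residue (x + k%:R * l) = residue x + k%:R * l.
  rewrite [in RHS]/residue addrAC; apply: residue_unique.
  have kx0 : residue x + k%:R * l < 0.
    case: k kl kmin {kn} => [_ _|k _ kmin]; first by rewrite mul0r addr0.
    have : ~~ (- residue x <= k.+1%:R * l) by apply/negP => /kmin; rewrite ltnn.
    by rewrite -ltNge; lra.
  move: kx0 x1; rewrite /residue.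
  have : 0 <= k%:R * l by rewrite mulr_ge0 // ltW.
  by move=> *; apply/andP; split; lra.
rewrite (bigD1 (Ordinal kn)) //= {1}/i kx.
have -> : (- l <= residue x + k%:R * l) by move: kl; rewrite -natr1; lra.
by rewrite lerDl sumr_ge0.
Qed.

End Residue.

(** * Quotients of quadratic functions *)

(** The infimum over fibres inherits one half of the parallelogram law; applied to
[u + v] and [u - v], this half gives the other one.  The source [E] is only
required to have operations that [pi] and [Q] respect, not to be a vector
space. *)
Lemma quotient_quadratic (R : realType) (F : scalar_field R) (E : Type)
    (V : lmodType F) (add : E -> E -> E) (scale : F -> E -> E) (pi : E -> V)
    (Q : E -> R) :
  (forall e f, pi (add e f) = pi e + pi f) ->
  (forall c e, pi (scale c e) = c *: pi e) ->
  (forall v, exists e, pi e = v) ->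
  (forall e, 0 <= Q e) ->
  (forall e f, Q (add e f) + Q (add e (scale (-1) f)) = 2 * Q e + 2 * Q f) ->
  (forall c e, Q (scale c e) = modulus c ^+ 2 * Q e) ->
  quadratic (fun v => inf [set Q e | e in [set e | pi e = v]]).
Proof.
move=> piD piZ pi_surj Q0 Qpar QZ; set q := fun v => inf _.
have q_le e : q (pi e) <= Q e.
  by apply: ge_inf; [exists 0 => _ [f _ <-]|exists e].
have q_near v eps : 0 < eps -> exists2 e, pi e = v & Q e < q v + eps.
  move=> e0; have [|_ [e ev <-]] := @inf_adherent _ [set Q e | e in [set e | pi e = v]] _ e0.
    split; last by exists 0 => _ [f _ <-].
    by have [e ev] := pi_surj v; exists (Q e); exists e.
  by exists e.
have q0 v : 0 <= q v.
  have [e ev] := pi_surj v.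
  by apply: lb_le_inf; [exists (Q e); exists e|move=> _ [f _ <-]].
have qpar_le u v : q (u + v) + q (u - v) <= 2 * q u + 2 * q v.
  apply/ler_addgt0Pr => eps eps0.
  have e4 : 0 < eps / 4 by rewrite divr_gt0.
  have [e <- eu] := q_near u _ e4; have [f <- fv] := q_near v _ e4.
  have := q_le (add e f); have := q_le (add e (scale (-1) f)).
  by rewrite !piD piZ scaleN1r; have := Qpar e f; lra.
have qZ_le c v : q (c *: v) <= modulus c ^+ 2 * q v.
  have [->|c0] := eqVneq c 0.
    have [e <-] := pi_surj v; rewrite -piZ (le_trans (q_le _)) // QZ.
    by rewrite modulus0 expr0n !mul0r.
  apply/ler_addgt0Pr => eps eps0.
  have c2 : 0 < modulus c ^+ 2 by rewrite exprn_gt0 // lt_neqAle modulus_ge0 eq_sym modulus_eq0 c0.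
  have [e <- ev] := q_near v _ (divr_gt0 eps0 c2).
  rewrite -piZ (le_trans (q_le _)) // QZ.
  move: ev => /ltW; rewrite -(ler_pM2l c2) mulrDr mulrCA divff ?gt_eqF // mulr1.
  by [].
have qZ c v : q (c *: v) = modulus c ^+ 2 * q v.
  apply: le_anti; rewrite qZ_le /=.
  have [->|c0] := eqVneq c 0.
    by rewrite modulus0 expr0n mul0r.
  rewrite -{1}[v](scalerK c0) (le_trans (ler_wpM2l _ (qZ_le _ _))) ?sqr_ge0 //.
  rewrite mulrA -exprMn -modulusM divff // modulus1 expr1n mul1r //.
split=> // u v; apply: le_anti; rewrite qpar_le /=.
have := qpar_le (u + v) (u - v).
have -> : u + v + (u - v) = @real_scalar R F 2 *: u.
  by rewrite addrACA subrr addr0 real_scalarD real_scalar1 scalerDl scale1r.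
have -> : u + v - (u - v) = @real_scalar R F 2 *: v.
  by rewrite opprB addrC addrA subrK real_scalarD real_scalar1 scalerDl scale1r.
by rewrite !qZ !modulus_real_scalar ger0_norm //; lra.
Qed.

(** * The decreasing energy of a superposition of orbits *)

Section Energy.
Context {R : realType} {F : scalar_field R} {H : completeNormedModType F}.
Context (T : R -> {linear H -> H}) (T0 : forall h, T 0 h = h)
  (TD : forall s t h, 0 <= s -> 0 <= t -> T (s + t) h = T s (T t h)).
Context (q1 q2 : H -> R) (q1q : quadratic q1) (q2q : quadratic q2).
Context (lambda tau : R) (lambda0 : 0 < lambda) (tau0 : 0 < tau).
Context (C1 C2 : R) (q1_ge : forall h, hnorm h ^+ 2 <= q1 h)
  (q1_le : forall h, q1 h <= C1 ^+ 2 * hnorm h ^+ 2)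
  (q2_ge : forall h, hnorm h ^+ 2 <= q2 h)
  (q2_le : forall h, q2 h <= C2 ^+ 2 * hnorm h ^+ 2).
Context (Tq1 : forall t h, 0 <= t -> q1 (T t h) <= expR (2 * lambda * t) * q1 h)
  (Tq2 : forall h, q2 (T tau h) <= q2 h).
Context (M : R) (M0 : 0 <= M)
  (TM : forall t h, 0 <= t <= Num.max 1 tau ->
    hnorm (T t h) ^+ 2 <= M * hnorm h ^+ 2).

Local Notation orbits := (seq ({nonneg R} * H)).
Implicit Types (e f : orbits) (x s : R) (h : H) (t : {nonneg R}).

(** A pair [(t, h)] is the orbit of [h] started at time [- t]. *)
Definition terminal e : H := \sum_(p <- e) T p.1%:num p.2.
Definition late e x : H := \sum_(p <- e | 0 <= x + p.1%:num) T (x + p.1%:num) p.2.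
Definition early e x : H := \sum_(p <- e | x + p.1%:num < 0) T p.1%:num p.2.
Definition delay t e : orbits := [seq ((t%:num + p.1%:num)%:nng, p.2) | p <- e].
Definition scale_orbits (c : F) e : orbits := [seq (p.1, c *: p.2) | p <- e].

Let q1_ge0 h : 0 <= q1 h. Proof. by case: q1q. Qed.
Let q2_ge0 h : 0 <= q2 h. Proof. by case: q2q. Qed.

Lemma terminal_cat e f : terminal (e ++ f) = terminal e + terminal f.
Proof. by rewrite /terminal big_cat. Qed.
Lemma late_cat e f x : late (e ++ f) x = late e x + late f x.
Proof. by rewrite /late big_cat. Qed.
Lemma early_cat e f x : early (e ++ f) x = early e x + early f x.
Proof. by rewrite /early big_cat. Qed.

Lemma terminal_scale c e : terminal (scale_orbits c e) = c *: terminal e.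
Proof.
by rewrite /terminal big_map scaler_sumr; apply: eq_bigr => p _; rewrite linearZ.
Qed.
Lemma late_scale c e x : late (scale_orbits c e) x = c *: late e x.
Proof.
by rewrite /late big_map scaler_sumr; apply: eq_bigr => p _; rewrite linearZ.
Qed.
Lemma early_scale c e x : early (scale_orbits c e) x = c *: early e x.
Proof.
by rewrite /early big_map scaler_sumr; apply: eq_bigr => p _; rewrite linearZ.
Qed.

Lemma terminal_delay t e : terminal (delay t e) = T t%:num (terminal e).
Proof.
by rewrite /terminal big_map linear_sum; apply: eq_bigr => p _; rewrite TD.
Qed.

Lemma late_delay t e x : late (delay t e) x = late e (x + t%:num).
Proof. by rewrite /late big_map /=; under eq_bigl do rewrite addrA;
  under eq_bigr do rewrite addrA. Qed.

Lemma early_delay t e x :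
  early (delay t e) x = T t%:num (early e (x + t%:num)).
Proof.
rewrite /early big_map linear_sum /=; under eq_bigl do rewrite addrA.
by apply: eq_bigr => p _; rewrite TD.
Qed.

Lemma early_pos e x : 0 <= x -> early e x = 0.
Proof.
move=> x0; rewrite /early big_pred0 // => p; apply/negbTE.
by rewrite -leNgt addr_ge0.
Qed.

(** At time 0 all orbits have started, so the superposition is then carried along
by the semigroup. *)
Lemma late_period e x : 0 <= x -> late e (x + tau) = T tau (late e x).
Proof.
move=> x0; rewrite /late linear_sum.
rewrite (eq_bigl (fun p => 0 <= x + p.1%:num)) => [|p]; last first.
  by rewrite !addr_ge0 // ltW.
by apply: eq_bigr => p xp; rewrite addrAC addrC TD // ltW.
Qed.

Lemma terminal_split e x : x <= 0 -> terminal e = early e x + T (- x) (late e x).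
Proof.
move=> x0; rewrite /terminal (bigID (fun p => x + p.1%:num < 0)) /=; congr (_ + _).
rewrite /late linear_sum; apply: eq_big => [p|p]; first by rewrite -leNgt.
by rewrite -leNgt => xp; rewrite -TD ?oppr_ge0 // addKr.
Qed.

Let ell := Num.min 1 tau.

(** Between the times [x] and [x + s] the weight grows by [expR (2 * lambda * s)],
which is the factor by which [T s] may increase [q1]. *)
Definition early_energy e x : R :=
  if - ell <= x < 0 then expR (2 * lambda * (x + 1)) * q1 (early e x) else 0.

(** Put [u := late e (x + tau)] and [v := late e x].  For [0 <= x] one has
[u = T tau v] and the value is [q2 v], which is also the first term of the energy
at time [x - tau].  At negative times orbits may start between [x] and
[x + tau]; the last term then keeps the energy above [q2 v / 2]. *)
Definition late_energy e x : R :=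
  q2 (late e (x + tau)) + (q2 (late e x) - q2 (T tau (late e x)))
  + q2 (late e (x + tau) - T tau (late e x)).

Lemma early_energy_ge0 e x : 0 <= early_energy e x.
Proof.
by rewrite /early_energy; case: ifP => // _; rewrite mulr_ge0 ?expR_ge0.
Qed.

Lemma late_energy_ge e x : q2 (late e x) / 2 <= late_energy e x.
Proof.
have [_ qpar _] := q2q.
rewrite /late_energy; set u := late e (x + tau); set v := T tau (late e x).
have := quadraticD_le q2q u (v - u); rewrite addrC subrK.
rewrite -(quadraticN q2q (v - u)) opprB; have := Tq2 (late e x); rewrite -/v.
by lra.
Qed.

Lemma late_energy_ge0 e x : 0 <= late_energy e x.
Proof. by apply: le_trans (late_energy_ge e x); rewrite divr_ge0. Qed.

Context (alpha beta : R) (alpha0 : 0 <= alpha) (beta0 : 0 <= beta).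

Definition energy e x := alpha * early_energy e x + beta * late_energy e x.

Lemma energy_ge0 e x : 0 <= energy e x.
Proof.
by rewrite addr_ge0 // mulr_ge0 // ?early_energy_ge0 ?late_energy_ge0.
Qed.

Lemma energy_parallelogram e f x :
  energy (e ++ f) x + energy (e ++ scale_orbits (-1) f) x = 2 * energy e x + 2 * energy f x.
Proof.
have [_ par1 _] := q1q; have [_ par2 _] := q2q.
have E : early_energy (e ++ f) x + early_energy (e ++ scale_orbits (-1) f) x
    = 2 * early_energy e x + 2 * early_energy f x.
  rewrite /early_energy; case: ifP => _; last by lra.
  by rewrite !early_cat early_scale scaleN1r -mulrDr par1; ring.
have L : late_energy (e ++ f) x + late_energy (e ++ scale_orbits (-1) f) x
    = 2 * late_energy e x + 2 * late_energy f x.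
  rewrite /late_energy !late_cat !late_scale !scaleN1r linearB linearD.
  set a := late e (x + tau); set b := late f (x + tau).
  set c := late e x; set d := late f x.
  have := par2 a b; have := par2 c d; have := par2 (T tau c) (T tau d).
  have := par2 (a - T tau c) (b - T tau d).
  rewrite [a - _ + _]addrACA -opprD.
  rewrite [a - T tau c - _](_ : _ = a - b - (T tau c - T tau d)); last first.
    by rewrite opprD addrACA -opprD.
  by lra.
by rewrite /energy addrACA -!mulrDr E L; ring.
Qed.

Lemma energy_scale c e x : energy (scale_orbits c e) x = modulus c ^+ 2 * energy e x.
Proof.
have [_ _ Z1] := q1q; have [_ _ Z2] := q2q.
rewrite /energy /early_energy /late_energy !late_scale early_scale.
rewrite [T tau (_ *: _)]linearZ /= -scalerBr !Z2 Z1.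
by case: ifP => _; ring.
Qed.

Lemma energy_delay t e x : - tau <= x < 0 ->
  energy (delay t e) x <= energy e (x + t%:num).
Proof.
move=> /andP[x1 x2]; rewrite lerD ?ler_wpM2l //; last first.
  by rewrite /late_energy !late_delay [x + tau + _]addrAC.
rewrite /early_energy; case: ifP => [/andP[xl _]|_]; last exact: early_energy_ge0.
rewrite early_delay; have [xt|xt] := ltP (x + t%:num) 0; last first.
  by rewrite early_pos // linear0 quadratic0 // mulr0; case: ifP.
have -> : - ell <= x + t%:num by rewrite (le_trans xl) // lerDl.
rewrite (le_trans (ler_wpM2l (expR_ge0 _) (Tq1 _ _))) // mulrA -expRD.
by rewrite addrAC -mulrDr [_ + t%:num]addrAC.
Qed.

(** One period later all orbits have started: [early_energy] vanishes and
[late_energy] reduces to [q2 (late e (x + tau))]. *)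
Lemma energy_period e x : - tau <= x -> energy e (x + tau) <= energy e x.
Proof.
move=> x1; have x0 : 0 <= x + tau by lra.
rewrite lerD ?ler_wpM2l //.
  by rewrite {1}/early_energy [_ < 0]ltNge x0 andbF early_energy_ge0.
rewrite {1}/late_energy !(late_period e x0) subrr quadratic0 // addr0.
rewrite addrC subrK /late_energy -addrA lerDl addr_ge0 // subr_ge0.
exact: Tq2.
Qed.

Lemma energy_periodn e x j : - tau <= x -> energy e (x + j%:R * tau) <= energy e x.
Proof.
move=> x1; elim: j => [|j IH]; first by rewrite mul0r addr0.
rewrite -natr1 mulrDl mul1r addrA (le_trans (energy_period _ _)) //.
by rewrite (le_trans x1) // lerDl mulr_ge0 // ltW.
Qed.

(** By the parallelogram law the energy of a superposition is at most twice the
sum of the energies, so a single orbit suffices; there [q2] is dominated by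
[q1], which grows at most exponentially. *)
Lemma energy_bounded e : is_bounded (fun x => energy e (residue tau x)).
Proof.
suff [B HB] : exists B, forall x, - tau <= x < 0 -> energy e x <= B.
  exists B => x; rewrite ger0_norm ?energy_ge0 //; apply/HB/residue_itv/tau0.
elim: e => [|[t h] e [B HB]].
  exists 0 => x _; rewrite /energy /early_energy /late_energy /early /late.
  by rewrite !big_nil [T tau 0]linear0 subr0 !quadratic0 // !(mulr0, addr0, subr0) if_same mulr0.
pose B1 := expR (2 * lambda) * (expR (2 * lambda * t%:num) * q1 h).
pose D := C2 ^+ 2 * (expR (2 * lambda * (tau + t%:num)) * q1 h).
have D0 : 0 <= D by rewrite mulr_ge0 ?sqr_ge0 // mulr_ge0 ?expR_ge0.
have late_le x : x < tau -> q2 (late [:: (t, h)] x) <= D.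
  move=> xt; rewrite /late big_mkcond big_seq1 /=; case: ifP => [x0|_]; last first.
    by rewrite quadratic0.
  rewrite (le_trans (q2_le _)) // ler_wpM2l ?sqr_ge0 //.
  rewrite (le_trans (q1_ge _)) // (le_trans (Tq1 _ _)) //.
  by rewrite ler_wpM2r // ler_expR ler_pM2l ?mulr_gt0 // lerD2r ltW.
have early_le x : q1 (early [:: (t, h)] x) <= expR (2 * lambda * t%:num) * q1 h.
  rewrite /early big_mkcond big_seq1 /=; case: ifP => _; first exact: Tq1.
  by rewrite quadratic0 // mulr_ge0 ?expR_ge0.
exists (2 * (alpha * B1 + beta * (6 * D)) + 2 * B) => x xI.
have /andP[x1 x2] := xI.
rewrite -cat1s; have := energy_parallelogram [:: (t, h)] e x.
have := energy_ge0 ([:: (t, h)] ++ scale_orbits (-1) e) x; have := HB x xI.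
suff : energy [:: (t, h)] x <= alpha * B1 + beta * (6 * D) by lra.
rewrite lerD // ler_wpM2l //.
  rewrite /early_energy; case: ifP => _; last by rewrite !mulr_ge0 ?expR_ge0.
  rewrite ler_pM ?expR_ge0 // ler_expR ler_piMr //; first by rewrite mulr_ge0 // ltW.
  by lra.
rewrite /late_energy; set u := late _ (x + tau); set v := late _ x.
have uD : q2 u <= D by apply: late_le; lra.
have vD : q2 v <= D by apply: late_le; lra.
have := quadraticD_le q2q u (- T tau v); rewrite (quadraticN q2q).
by have := q2_ge0 (T tau v); have := Tq2 v; lra.
Qed.

Context (m : (R -> R) -> R) (mean_m : invariant_mean m).

(** The substitute for the integral of the energy over [[- tau, 0[]. *)
Definition mean_energy e := m (fun x => energy e (residue tau x)).
Let window := m (fun x => (- ell <= residue tau x)%R%:R).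

Lemma mean_energy_ge0 e : 0 <= mean_energy e.
Proof.
have [_ mZ mle m1 _] := mean_m.
have b1 : is_bounded (fun=> 1 : R) by exists 1 => x; rewrite normr1.
rewrite -(mul0r (m (fun=> 1))) -mZ //; apply: mle; last first.
- by move=> x; rewrite mul0r energy_ge0.
- exact: energy_bounded.
by exists 0 => x; rewrite mul0r normr0.
Qed.

Lemma mean_energy_parallelogram e f :
  mean_energy (e ++ f) + mean_energy (e ++ scale_orbits (-1) f)
  = 2 * mean_energy e + 2 * mean_energy f.
Proof.
have [mD mZ _ _ _] := mean_m.
have b2 g : is_bounded (fun x => 2 * energy g (residue tau x)).
  have [B HB] := energy_bounded g; exists (2 * B) => x.
  by rewrite normrM ger0_norm // ler_wpM2l.
rewrite -!mZ -?mD //; try exact: energy_bounded.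
by congr m; apply/funext => x; rewrite energy_parallelogram.
Qed.

Lemma mean_energy_scale c e : mean_energy (scale_orbits c e) = modulus c ^+ 2 * mean_energy e.
Proof.
have [_ mZ _ _ _] := mean_m; rewrite -mZ; last exact: energy_bounded.
by congr m; apply/funext => x; rewrite energy_scale.
Qed.

(** Translating by [t] replaces the period [[- tau, 0[] by [[t - tau, t[], whose
points arise from those of [[- tau, 0[] by moving forward by multiples of
[tau]. *)
Lemma mean_energy_delay t e : mean_energy (delay t e) <= mean_energy e.
Proof.
have [_ _ mle _ mshift] := mean_m.
have be := energy_bounded e.
rewrite /mean_energy -(mshift t%:num (fun x => energy e (residue tau x))) //.
apply: mle; [exact: energy_bounded|by case: be => B HB; exists B|move=> x].
rewrite (le_trans (energy_delay _ _ _)) ?residue_itv //.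
have [|j ->] := @residue_shift _ _ tau0 x t%:num; first by [].
by rewrite energy_periodn //; case/andP: (residue_itv tau0 (x + t%:num)).
Qed.

Lemma hnorm_split_le (eps : R) (u v : H) : 0 < eps ->
  hnorm (u + v) ^+ 2 <= (1 + eps) * hnorm u ^+ 2 + (1 + eps^-1) * hnorm v ^+ 2.
Proof.
move=> e0.
apply: (@le_trans _ _ ((hnorm u + hnorm v) ^+ 2)).
  by rewrite ler_pXn2r ?nnegrE ?addr_ge0 ?hnorm_ge0 // hnorm_triangle.
have : 0 <= eps * (hnorm u - eps^-1 * hnorm v) ^+ 2.
  by rewrite mulr_ge0 ?sqr_ge0 // ltW.
have -> : eps * (hnorm u - eps^-1 * hnorm v) ^+ 2
  = eps * hnorm u ^+ 2 - 2 * (hnorm u * hnorm v) + eps^-1 * hnorm v ^+ 2.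
  by field; rewrite gt_eqF.
by lra.
Qed.

Context (eps : R) (eps0 : 0 < eps) (window0 : 0 < window)
  (alphaE : alpha * window = 1 + eps)
  (betaE : beta * window = (1 + eps^-1) * (2 * M)).

Let window_bounded : is_bounded (fun x => (- ell <= residue tau x)%R%:R : R).
Proof.
by exists 1 => x; case: (- ell <= _); rewrite ?normr1 ?normr0.
Qed.

(** At each time of the window, [terminal_split] and [hnorm_split_le] bound
[hnorm (terminal e) ^+ 2] by [window] times the energy. *)
Lemma mean_energy_ge e : hnorm (terminal e) ^+ 2 <= mean_energy e.
Proof.
have [_ mZ mle _ _] := mean_m.
have be := energy_bounded e.
rewrite -(ler_pM2l window0) mulrC -mZ // /mean_energy -mZ //.
apply: mle => [||x].
- case: window_bounded => B HB; exists (hnorm (terminal e) ^+ 2 * B) => x.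
  by rewrite normrM ger0_norm ?sqr_ge0 // ler_wpM2l ?sqr_ge0.
- case: be => B HB; exists (window * B) => x.
  by rewrite normrM ger0_norm ?(ltW window0) // ler_wpM2l ?(ltW window0).
have /andP[x1 x2] := residue_itv tau0 x; set y := residue tau x in x1 x2 *.
have [yl|yl] := boolP (- ell <= y); last first.
  by rewrite mulr0 mulr_ge0 ?energy_ge0 // ltW.
rewrite mulr1 /energy mulrDr !mulrA ![window * _]mulrC alphaE betaE.
rewrite (terminal_split e (ltW x2)) (le_trans (hnorm_split_le _ _ eps0)) //.
rewrite lerD //.
  rewrite ler_wpM2l ?addr_ge0 ?(ltW eps0) // /early_energy yl x2 /=.
  rewrite (le_trans (q1_ge _)) // ler_peMl // -[leLHS]expR0 ler_expR.
  have ell1 : ell <= 1 by rewrite ge_min lexx.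
  apply: mulr_ge0; first by rewrite mulr_ge0 // ltW.
  by lra.
rewrite -mulrA ler_wpM2l ?addr_ge0 ?invr_ge0 ?(ltW eps0) //.
have y3 : 0 <= - y <= Num.max 1 tau.
  have : ell <= 1 by rewrite ge_min lexx.
  have : 1 <= Num.max 1 tau by rewrite le_max lexx.
  by move=> *; apply/andP; split; lra.
rewrite (le_trans (TM _ y3)) // [2 * M]mulrC -mulrA ler_wpM2l //.
rewrite (le_trans (q2_ge _)) //.
by have := late_energy_ge e y; lra.
Qed.

(** An orbit started at time 0 has [early] equal to [h] and [late] equal to 0
throughout the period, while [late] one period later is [T (x + tau) h]. *)
Lemma mean_energy_single_le h : mean_energy [:: (0%:nng, h)] <=
  (alpha * window * (C1 ^+ 2 * expR (2 * lambda)) + beta * (2 * C2 ^+ 2 * M))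
  * hnorm h ^+ 2.
Proof.
have [mD mZ mle m1 _] := mean_m.
pose A := alpha * (C1 ^+ 2 * expR (2 * lambda)) * hnorm h ^+ 2.
pose B := beta * (2 * C2 ^+ 2 * M) * hnorm h ^+ 2.
pose i x : R := (- ell <= residue tau x)%R%:R.
have b1 : is_bounded (fun=> 1 : R) by exists 1 => x; rewrite normr1.
have bi : is_bounded (fun x => A * i x).
  case: window_bounded => D HD; exists (`|A| * D) => x.
  by rewrite normrM ler_wpM2l ?normr_ge0 //; exact: HD.
have bB : is_bounded (fun x => B * 1) by exists `|B| => x; rewrite mulr1.
have -> : (alpha * window * (C1 ^+ 2 * expR (2 * lambda)) + beta * (2 * C2 ^+ 2 * M))
    * hnorm h ^+ 2 = m (fun x => A * i x + B * 1).
  by rewrite mD // !mZ // m1 -/window /A /B; ring.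
apply: mle => [||x]; first exact: energy_bounded.
  case: bi bB => D HD [D' HD']; exists (D + D') => x.
  by rewrite (le_trans (ler_normD _ _)) //; apply: lerD; [exact: HD|exact: HD'].
have /andP[x1 x2] := residue_itv tau0 x; rewrite /i; set y := residue tau x in x1 x2 *.
rewrite /energy lerD //.
  rewrite /early_energy x2 andbT; case: (- ell <= y); last by rewrite !mulr0.
  rewrite mulr1 /A -[leRHS]mulrA ler_wpM2l // [_ ^+ 2 * _]mulrC -[leRHS]mulrA.
  rewrite ler_pM ?expR_ge0 //.
    rewrite ler_expR ler_piMr //; first by rewrite mulr_ge0 // ltW.
    by lra.
  rewrite /early big_mkcond big_seq1 /= addr0 x2 T0; exact: q1_le.
rewrite mulr1 /B -[leRHS]mulrA ler_wpM2l //.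
have -> : late_energy [:: (0%:nng, h)] y = 2 * q2 (T (y + tau) h).
  have lateE z : late [:: (0%:nng, h)] z = if 0 <= z then T z h else 0.
    by rewrite /late big_mkcond big_seq1 /= addr0.
  have y0 : 0 <= y + tau by lra.
  rewrite /late_energy !lateE y0 leNgt x2 /= linear0 quadratic0 //.
  by rewrite !subr0 addr0; ring.
rewrite -mulrA -mulrA ler_pM2l // (le_trans (q2_le _)) // ler_wpM2l ?sqr_ge0 //.
apply: TM; have : tau <= Num.max 1 tau by rewrite le_max lexx orbT.
by move=> *; apply/andP; split; lra.
Qed.

Theorem renorming : exists q : H -> R, [/\ quadratic q,
  forall h, hnorm h ^+ 2 <= q h,
  forall h, q h <= (alpha * window * (C1 ^+ 2 * expR (2 * lambda))
    + beta * (2 * C2 ^+ 2 * M)) * hnorm h ^+ 2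
  & forall (t : R) h, 0 <= t -> q (T t h) <= q h].
Proof.
have terminal1 h : terminal [:: (0%:nng, h)] = h.
  by rewrite /terminal big_seq1 T0.
exists (fun h => inf [set mean_energy e | e in [set e | terminal e = h]]).
have lb h : has_lbound [set mean_energy e | e in [set e | terminal e = h]].
  by exists 0 => _ [e _ <-]; exact: mean_energy_ge0.
split.
- apply: (quotient_quadratic (add := cat) (scale := scale_orbits)).
  + exact: terminal_cat.
  + exact: terminal_scale.
  + by move=> h; exists [:: (0%:nng, h)].
  + exact: mean_energy_ge0.
  + exact: mean_energy_parallelogram.
  + exact: mean_energy_scale.
- move=> h; apply: lb_le_inf; first by exists (mean_energy [:: (0%:nng, h)]), [:: (0%:nng, h)].
  by move=> _ [e <- <-]; exact: mean_energy_ge.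
- move=> h; rewrite (le_trans _ (mean_energy_single_le h)) //.
  by apply: ge_inf => //; exists [:: (0%:nng, h)].
move=> t h t0; apply: lb_le_inf.
  by exists (mean_energy [:: (0%:nng, h)]), [:: (0%:nng, h)].
move=> _ [e eh <-]; rewrite (le_trans _ (mean_energy_delay (NngNum t0) e)) //.
by apply: ge_inf => //; exists (delay (NngNum t0) e) => //=; rewrite terminal_delay eh.
Qed.

End Energy.

(** * Comparison of the constants *)

(** Doubling: [expR x - expR (- x)] at [x] is at least twice its value at [x / 2],
so the defect in the crude bound [2 * x - x ^+ 2] is halved at each step. *)
Lemma expRB_ge2x (R : realType) (x : R) : 0 <= x -> 2 * x <= expR x - expR (- x).
Proof.
move=> x0; rewrite -subr_le0.
have half01 : 0 <= (2^-1 : R) < 1 by apply/andP; split; lra.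
apply: (@geometric_le0 _ 2^-1 (x ^+ 2)) => // n.
elim: n x x0 => [|n IH] x x0.
  rewrite expr0 mulr1 expRN.
  have : (expR x)^-1 <= (1 + x)^-1.
    by rewrite lef_pV2 ?posrE ?expR_gt0 ?expR_ge1Dx // ltr_pwDl.
  have : (1 + x)^-1 <= 1 - x + x ^+ 2.
    rewrite -[leLHS]mul1r ler_pdivrMr ?ltr_pwDl //.
    have : 0 <= x ^+ 3 by rewrite exprn_ge0.
    by rewrite (_ : (1 - x + x ^+ 2) * (1 + x) = 1 + x ^+ 3); [lra|ring].
  by have := expR_ge1Dx x; lra.
have h0 : 0 <= x / 2 by rewrite divr_ge0.
have := IH _ h0; set E := expR (x / 2); set e := expR (- (x / 2)).
have Ee : E * e = 1 by rewrite expRxMexpNx_1.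
have -> : expR x = E ^+ 2 by rewrite expr2 -expRD -splitr.
have -> : expR (- x) = e ^+ 2 by rewrite expr2 -expRD -opprD -splitr.
have E2 : 2 <= E + e.
  rewrite -(ler_pXn2r (n := 2)) ?nnegrE ?addr_ge0 ?expR_ge0 //.
  have -> : (E + e) ^+ 2 = (E - e) ^+ 2 + 4 * (E * e) by ring.
  by have := sqr_ge0 (E - e); rewrite Ee; lra.
have Eme : 0 <= E - e by rewrite subr_ge0 ler_expR; lra.
have := ler_wpM2l Eme E2.
have -> : (E - e) * (E + e) = E ^+ 2 - e ^+ 2 by ring.
rewrite [2^-1 ^+ n.+1]exprS (_ : (x / 2) ^+ 2 = x ^+ 2 / 4); last by field.
set r := _ ^+ n; lra.
Qed.

Lemma expR_lt_sinh (R : realType) (x : R) : 0 < x -> expR x < sinh (2 * x) / x.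
Proof.
move=> x0; rewrite /sinh ltr_pdivlMr // -mulrN !expRM_natl.
have := ler_wpM2r (addr_ge0 (expR_ge0 x) (expR_ge0 (- x))) (expRB_ge2x (ltW x0)).
have := mulr_gt0 x0 (expR_gt0 (- x)).
rewrite (_ : (expR x - expR (- x)) * _ = expR x ^+ 2 - expR (- x) ^+ 2); last by ring.
by lra.
Qed.

(** * Operator norms and the similarity constant *)

Section OperatorNorms.
Context {R : realType} {F : scalar_field R} {H : completeNormedModType F}.
Implicit Types (N : H -> R) (A : {linear H -> H}) (h : H) (c : R).

Lemma opnorm_ge0 N A : N 0 = 0 -> (0 <= opnorm N A)%E.
Proof.
move=> N0; apply: ereal_sup_ubound; exists 0 => /=; first by rewrite N0.
by rewrite linear0 N0.
Qed.

Lemma opnorm_bound N A c h : hilbertian_norm N -> (forall u, hnorm u <= N u) ->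
  (opnorm N A <= c%:E)%E -> N (A h) <= c * N h.
Proof.
move=> hN Nge Ac; have [_ _ NZ] := hilbertian_norm_quadratic hN.
have N_ge0 u : 0 <= N u by rewrite (le_trans _ (Nge u)) // hnorm_ge0.
have NZ1 (k : F) u : N (k *: u) = modulus k * N u.
  apply/eqP; rewrite -(eqrXn2 (n := 2)) // ?mulr_ge0 ?modulus_ge0 //.
  by rewrite NZ exprMn.
have N0 : N 0 = 0 by rewrite -(scale0r 0) NZ1 modulus0 mul0r.
have [h0|h0] := eqVneq (N h) 0.
  have -> : h = 0.
    by apply: hnorm_eq0; apply: le_anti; rewrite hnorm_ge0 -h0 Nge.
  by rewrite linear0 N0 mulr0.
have hp : 0 < N h by rewrite lt_neqAle eq_sym h0 N_ge0.
pose k : F := real_scalar F (N h)^-1.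
have kE : modulus k = (N h)^-1 by rewrite modulus_real_scalar ger0_norm // invr_ge0.
have : ((N (A (k *: h)))%:E <= c%:E)%E.
  apply: le_trans Ac; apply: ereal_sup_ubound; exists (k *: h) => //=.
  by rewrite NZ1 kE mulVf.
by rewrite linearZ NZ1 kE lee_fin ler_pdivrMl // mulrC.
Qed.

Lemma hnorm_opnorm_le A c : (forall h, hnorm (A h) <= c * hnorm h) -> 0 <= c ->
  (opnorm hnorm A <= c%:E)%E.
Proof.
move=> Ac c0; apply: ge_ereal_sup => _ [h h1 <-].
by rewrite lee_fin (le_trans (Ac h)) // ler_piMr.
Qed.

Lemma hnorm_bounded_operator A c : (forall h, hnorm (A h) <= c * hnorm h) ->
  bounded_operator A.
Proof.
move=> Ac; apply/linear_boundedP; near=> r => h.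
rewrite -!real_scalar_hnorm (@le_trans _ _ (real_scalar F c * real_scalar F (hnorm h))) //.
  by rewrite -real_scalarM ler_real_scalar.
rewrite ler_wpM2r ?real_scalar_ge0 ?hnorm_ge0 //.
near: r; apply: nbhs_pinfty_ge.
by rewrite realE -(@real_scalar0 R F) !ler_real_scalar le_total.
Unshelve. all: by end_near. Qed.

End OperatorNorms.

(** The square root [A] of [q] is an isometry from [sqrt q] to the given norm. *)
Lemma contractive_similarity (R : realType) (F : scalar_field R)
  (H : completeNormedModType F) (T : R -> {linear H -> H}) (q : H -> R) (K : R) :
  hilbertian_norm (@hnorm R F H) -> quadratic q -> 1 <= K ->
  (forall h, hnorm h ^+ 2 <= q h) -> (forall h, q h <= (K * hnorm h) ^+ 2) ->
  (forall (t : R) h, 0 <= t -> q (T t h) <= q h) ->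
  (similarity_constant T <= K%:E)%E.
Proof.
move=> hH qq K1 q1 qK qT.
have K0 : 0 <= K by rewrite (le_trans ler01).
have [A [B [AB BA Aq]]] := quadratic_square_root hH qq K1 q1 qK.
have sqr_le (x y : R) : 0 <= x -> 0 <= y -> x ^+ 2 <= y ^+ 2 -> x <= y.
  by move=> x0 y0; rewrite ler_pXn2r.
have An h : hnorm (A h) <= K * hnorm h.
  by apply: sqr_le; rewrite ?mulr_ge0 ?hnorm_ge0 // Aq.
have Bn h : hnorm (B h) <= 1 * hnorm h.
  by apply: sqr_le; rewrite ?mulr_ge0 ?hnorm_ge0 // mul1r -{2}[h]BA Aq.
apply: (@le_trans _ _ (opnorm hnorm A * opnorm hnorm B)%E).
  apply: ereal_inf_lbound; exists A, B; split=> //.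
    by split=> //; apply: hnorm_bounded_operator.
  move=> t t0; apply: ge_ereal_sup => _ [h h1 <-]; rewrite lee_fin /=.
  apply: le_trans h1; apply: sqr_le; rewrite ?hnorm_ge0 // Aq.
  by rewrite (le_trans (qT _ _ t0)) // -Aq BA.
have hn0 : hnorm (0 : H) = 0 by rewrite /hnorm normr0 re0.
rewrite -[leRHS]mule1; apply: lee_pmul; try exact: opnorm_ge0.
  exact: hnorm_opnorm_le.
exact: hnorm_opnorm_le.
Qed.

Theorem proposition3p7 (R : realType) (F : scalar_field R)
  (H : completeNormedModType F) (T : R -> {linear H -> H})
  (N1 N2 : H -> R) (C1 C2 lambda tau : R) :
  hilbertian_norm (@hnorm R F H) ->
  semigroup T ->
  hilbertian_norm N1 -> hilbertian_norm N2 ->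
  equivalent_norms hnorm N1 -> equivalent_norms hnorm N2 ->
  1 <= C1 -> 1 <= C2 -> 0 < lambda -> 0 < tau ->
  (forall h, hnorm h <= N1 h <= C1 * hnorm h) ->
  (forall h, hnorm h <= N2 h <= C2 * hnorm h) ->
  (forall t, 0 <= t -> (opnorm N1 (T t) <= (expR (lambda * t))%:E)%E) ->
  (opnorm N2 (T tau) <= 1)%E ->
  (similarity_constant T <=
     (C1 * (sinh (2 * lambda) / lambda))%:E +
     (2 * Num.sqrt 2 * C2 * Num.max 1 (Num.sqrt tau))%:E *
       ereal_sup [set opnorm hnorm (T t) ^+ 2 |
                   t in [set t : R | (0 <= t <= Num.max 1 tau)%R]])%E.
Proof.
move=> hH [_ T0 TD] hN1 hN2 _ _ C1_ge1 C2_ge1 lambda0 tau0 N1b N2b TN1 TN2.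
set c := 2 * Num.sqrt 2 * C2 * Num.max 1 (Num.sqrt tau).
have tau_ge0 : 0 <= tau by rewrite ltW.
have c0 : 0 < c.
  have C2_gt0 : 0 < C2 by rewrite (lt_le_trans ltr01).
  have m0 : 0 < Num.max 1 (Num.sqrt tau) by rewrite lt_max ltr01.
  by rewrite !mulr_gt0 ?sqrtr_gt0.
set S := ereal_sup _.
have max0 : 0 <= Num.max 1 tau by rewrite le_max ler01.
have hn0 : hnorm (0 : H) = 0 by rewrite /hnorm normr0 re0.
have S_ge t : 0 <= t <= Num.max 1 tau -> (opnorm hnorm (T t) ^+ 2 <= S)%E.
  by move=> t01; apply: ereal_sup_ubound; exists t.
have S0 : (0 <= S)%E.
  have T0_le := S_ge 0; rewrite lexx max0 in T0_le.
  by apply: le_trans (T0_le isT); rewrite sqre_ge0.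
have := S0; case SE : S => [M| |] // M0; last first.
  (* an infinite supremum makes the bound trivial *)
  by rewrite gt0_muley ?lte_fin // addey // leey.
rewrite lee_fin in M0.
have TM t h : 0 <= t <= Num.max 1 tau -> hnorm (T t h) ^+ 2 <= M * hnorm h ^+ 2.
  move=> t01.
  have : (opnorm hnorm (T t) ^+ 2 <= M%:E)%E.
    by rewrite -SE; exact: S_ge.
  have := opnorm_ge0 (N := hnorm) (T t) hn0.
  case E : (opnorm hnorm (T t)) => [nT| |] //; rewrite lee_fin => n0.
  rewrite -EFin_expe lee_fin => nM.
  have Th : hnorm (T t h) <= nT * hnorm h.
    by apply: opnorm_bound => //; rewrite E.
  rewrite (@le_trans _ _ ((nT * hnorm h) ^+ 2)) //.
    by rewrite ler_pXn2r ?nnegrE ?mulr_ge0 ?hnorm_ge0.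
  by rewrite exprMn ler_wpM2r ?sqr_ge0.
pose q1 h := N1 h ^+ 2; pose q2 h := N2 h ^+ 2.
have q1q : quadratic q1 by exact: hilbertian_norm_quadratic.
have q2q : quadratic q2 by exact: hilbertian_norm_quadratic.
have N1_ge h : hnorm h <= N1 h by case/andP: (N1b h).
have N2_ge h : hnorm h <= N2 h by case/andP: (N2b h).
have sq_le (x y : R) : 0 <= x -> x <= y -> x ^+ 2 <= y ^+ 2.
  by move=> x0 xy; rewrite ler_pXn2r ?nnegrE // (le_trans x0).
have q1_ge h : hnorm h ^+ 2 <= q1 h by rewrite sq_le ?hnorm_ge0.
have q2_ge h : hnorm h ^+ 2 <= q2 h by rewrite sq_le ?hnorm_ge0.
have N1_ge0 h : 0 <= N1 h by rewrite (le_trans (hnorm_ge0 h)).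
have N2_ge0 h : 0 <= N2 h by rewrite (le_trans (hnorm_ge0 h)).
have q1_le h : q1 h <= C1 ^+ 2 * hnorm h ^+ 2.
  by rewrite -exprMn sq_le //; case/andP: (N1b h).
have q2_le h : q2 h <= C2 ^+ 2 * hnorm h ^+ 2.
  by rewrite -exprMn sq_le //; case/andP: (N2b h).
have Tq1 t h : 0 <= t -> q1 (T t h) <= expR (2 * lambda * t) * q1 h.
  move=> t0; rewrite -mulrA expRM_natl -exprMn sq_le //.
  by apply: opnorm_bound => //; exact: TN1.
have Tq2 h : q2 (T tau h) <= q2 h.
  by rewrite sq_le // -[leRHS]mul1r; apply: opnorm_bound.
have [m mean_m] := @exists_invariant_mean R.
pose w := m (fun x => (- Num.min 1 tau <= residue tau x)%R%:R).
(* [truncn tau + 1 <= 2 * max 1 tau] translates of the window cover a period *)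
have w_ge : 1 <= 2 * Num.max 1 tau * w.
  have ell0 : 0 < Num.min 1 tau <= tau.
    by rewrite lt_min ltr01 tau0 ge_min lexx orbT.
  pose n := (Num.truncn tau).+1.
  have tn : tau < n%:R by exact: truncnS_gt.
  have nt : n%:R <= 2 * Num.max 1 tau.
    have : (Num.truncn tau)%:R <= tau by rewrite truncn_le.
    have : 1 <= Num.max 1 tau by rewrite le_max lexx.
    have : tau <= Num.max 1 tau by rewrite le_max lexx orbT.
    by rewrite /n -natr1; lra.
  have nl : tau <= n%:R * Num.min 1 tau.
    rewrite /Num.min; case: ltP => _; first by rewrite mulr1 ltW.
    by rewrite ler_peMl // ler1n.
  have w1 := window_mean tau0 mean_m ell0 nl.
  rewrite (le_trans w1) // ler_wpM2r //.
  rewrite -(pmulr_rge0 _ (_ : 0 < n%:R)) ?ltr0n //.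
  by rewrite (le_trans _ w1).
have w0 : 0 < w.
  have : 0 < 2 * Num.max 1 tau * w by rewrite (lt_le_trans ltr01).
  by rewrite pmulr_rgt0 // mulr_gt0 // lt_max ltr01.
pose k1 := C1 * expR lambda; pose k2 := c * M.
pose K := C1 * (sinh (2 * lambda) / lambda) + k2.
have C1_gt0 : 0 < C1 by rewrite (lt_le_trans ltr01).
have C2_ge0 : 0 <= C2 by rewrite (le_trans ler01).
have k1_ge1 : 1 <= k1.
  by rewrite -[1]mul1r ler_pM // -expR0 ler_expR ltW.
have k2_ge0 : 0 <= k2 by rewrite mulr_ge0 // ltW.
have k1K : k1 + k2 < K by rewrite ltrD2r ltr_pM2l // expR_lt_sinh.
(* this choice gives [(1 + eps) k1^2 + (1 + eps^-1) (K - k1)^2 = K^2]; the strict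
inequality [k1 < K] keeps [eps] positive even when [M = 0] *)
pose eps := (K - k1) / k1.
have eps0 : 0 < eps by rewrite divr_gt0 //; lra.
pose alpha := (1 + eps) / w; pose beta := (1 + eps^-1) * (2 * M) / w.
have alpha0 : 0 <= alpha by rewrite divr_ge0 ?addr_ge0 ?(ltW eps0) ?(ltW w0).
have beta0 : 0 <= beta.
  by rewrite divr_ge0 ?mulr_ge0 ?addr_ge0 ?invr_ge0 ?(ltW eps0) ?(ltW w0).
have alphaE : alpha * w = 1 + eps by rewrite divfK // gt_eqF.
have betaE : beta * w = (1 + eps^-1) * (2 * M) by rewrite divfK // gt_eqF.
have [q [qq q_ge q_le qT]] := renorming T0 TD q1q q2q lambda0 tau0 q1_ge q1_le
  q2_ge q2_le Tq1 Tq2 M0 TM alpha0 beta0 mean_m eps0 w0 alphaE betaE.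
rewrite -EFinM -EFinD -/k2 -/K.
apply: (contractive_similarity hH qq) => //; first by lra.
move=> h; rewrite (le_trans (q_le h)) // exprMn ler_wpM2r ?sqr_ge0 // alphaE.
have c_sq : c ^+ 2 = 8 * C2 ^+ 2 * Num.max 1 tau.
  have -> : Num.max 1 tau = Num.max 1 (Num.sqrt tau) ^+ 2.
    have [t1|t1] := leP 1 tau.
      by rewrite max_r ?sqr_sqrtr // -[leLHS]sqrtr1 ler_wsqrtr.
    by rewrite max_l ?expr1n // -[leRHS]sqrtr1 ler_wsqrtr // ltW.
  by rewrite /c !exprMn sqr_sqrtr //; ring.
have lateK : beta * (2 * C2 ^+ 2 * M) <= (1 + eps^-1) * k2 ^+ 2.
  have -> : beta * (2 * C2 ^+ 2 * M) = (1 + eps^-1) * (4 * C2 ^+ 2 * M ^+ 2 / w).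
    by rewrite /beta; ring.
  rewrite ler_wpM2l ?addr_ge0 ?invr_ge0 ?(ltW eps0) //.
  rewrite ler_pdivrMr // /k2 exprMn c_sq.
  have -> : 8 * C2 ^+ 2 * Num.max 1 tau * M ^+ 2 * w
    = 4 * C2 ^+ 2 * M ^+ 2 * (2 * Num.max 1 tau * w) by ring.
  by rewrite ler_peMr // mulr_ge0 ?sqr_ge0 // mulr_ge0 ?sqr_ge0.
have k1_gt0 : 0 < k1 by lra.
have d0 : 0 < K - k1 by lra.
have kd : k2 ^+ 2 <= (K - k1) ^+ 2 by rewrite sq_le //; lra.
have epsV : 0 <= 1 + eps^-1 by rewrite addr_ge0 ?invr_ge0 ?(ltW eps0).
have := ler_wpM2l epsV kd.
have -> : K ^+ 2 = (1 + eps) * k1 ^+ 2 + (1 + eps^-1) * (K - k1) ^+ 2.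
  by rewrite /eps; field; rewrite !gt_eqF.
have -> : (1 + eps) * (C1 ^+ 2 * expR (2 * lambda)) = (1 + eps) * k1 ^+ 2.
  by rewrite expRM_natl /k1 exprMn.
by lra.
Qed.
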